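(* Let $k\ge 0$ be an integer and $n=2k+1$. Let $E_3O_1(n)$ (respectively $E_1O_3(n)$) be the set of partitions $\lambda=(\lambda_1\ge\lambda_2\ge\lambda_3\ge\lambda_4\ge 0)$ of $n$ such that among $\lambda_1,\ldots,\lambda_4$ exactly three are even and one is odd (respectively exactly one is even and three are odd), where $0$ counts as an even part. Then $$S^2([k+1,k])=\sum_{\lambda\in E_3O_1(n)}[\lambda],\qquad A^2([k+1,k])=\sum_{\lambda\in E_1O_3(n)}[\lambda].$$
   Context: For a partition $\lambda$ of $n$, $[\lambda]$ denotes the irreducible complex character of the symmetric group $S_n$ labelled by $\lambda$. For a character $\chi$ of a finite group, $S^2(\chi)(g)=\tfrac12(\chi(g)^2+\chi(g^2))$ and $A^2(\chi)(g)=\tfrac12(\chi(g)^2-\chi(g^2))$ are the symmetric and anti-symmetric parts of $\chi^2$. *)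

(* Defs.v *)
From HB Require Import structures.
From mathcomp Require Import all_boot all_order all_algebra.
From mathcomp Require Import all_fingroup all_solvable all_field all_character.

Set Implicit Arguments.
Unset Strict Implicit.
Unset Printing Implicit Defensive.

Import GroupScope GRing.Theory.
Local Open Scope ring_scope.

Section SquareParts.

Variables (gT : finGroupType) (G : {group gT}).
Implicit Type phi : 'CF(G).

Fact cfAdams2_subproof phi :
  is_class_fun <<G>> [ffun g => if g \in G then phi (g ^+ 2)%g else 0].
Proof.
rewrite genGid; apply: intro_class_fun => [x y Gx Gy | x /negPf-> //].
by rewrite groupJ // Gx -conjXg cfunJ.
Qed.
(* The test g \in G is needed since g ^+ 2 may lie in G when g does not. *)
Definition cfAdams2 phi : 'CF(G) := Cfun 0 (cfAdams2_subproof phi).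

Definition cfSym2 phi : 'CF(G) := 2%:R^-1 *: (phi ^+ 2 + cfAdams2 phi).
Definition cfAlt2 phi : 'CF(G) := 2%:R^-1 *: (phi ^+ 2 - cfAdams2 phi).

End SquareParts.

Section SymmetricGroupIrr.

Variable n : nat.

Fact cfSgn_subproof :
  is_class_fun <<[set: 'S_n]>> [ffun s : 'S_n => (-1) ^+ odd_perm s : algC].
Proof.
rewrite genGid; apply: intro_class_fun => [x y _ _ | x]; last by rewrite inE.
by rewrite odd_permJ.
Qed.
Definition cfSgn : 'CF([set: 'S_n]) := Cfun 0 cfSgn_subproof.

(* For a composition a of n, reshape_index a cuts 0, ..., n.-1 into consecutive
   blocks of lengths a`_0, a`_1, ... *)
Definition young_set (a : seq nat) : {set 'S_n} :=
  [set s : 'S_n | [forall i, reshape_index a (s i) == reshape_index a i]].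

Fact young_set_group a : group_set (young_set a).
Proof.
apply/group_setP; split=> [|s t].
  by rewrite inE; apply/forallP=> i; rewrite perm1.
rewrite !inE => /forallP Hs /forallP Ht; apply/forallP=> i.
by rewrite permM (eqP (Ht _)).
Qed.
Canonical young_group a : {group 'S_n} := Group (young_set_group a).

Definition conj_part (la : seq nat) : seq nat :=
  [seq count (fun p => j < p)%N la | j <- iota 0 (sumn la)].

(* The James-Kerber definition of [la]: for a partition la of n, the
   representations of S_n induced from the trivial representation of the Young
   subgroup of la and from the sign representation of the Young subgroup of the
   conjugate partition have exactly one irreducible constituent in common, and
   [la] is its character.  Trailing zero parts of la are immaterial; the
   default value 0 is not used when la is a partition of n. *)
Definition part_irr (la : seq nat) : 'CF([set: 'S_n]) :=
  if [pick i : Iirr [set: 'S_n] |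
        (i \in irr_constt ('Ind[[set: 'S_n]] (1 : 'CF(young_group la))))
     && (i \in irr_constt
          ('Ind[[set: 'S_n]] ('Res[young_group (conj_part la)] cfSgn)))]
  is Some i then 'chi_i else 0.

End SymmetricGroupIrr.

Definition parts4 n (la : 4.-tuple 'I_n.+1) : seq nat := [seq val p | p <- la].

Definition partitions4 (n : nat) : {set 4.-tuple 'I_n.+1} :=
  [set la | sorted geq (parts4 la) & sumn (parts4 la) == n].

Definition E3O1 (n : nat) : {set 4.-tuple 'I_n.+1} :=
  [set la in partitions4 n | (count (predC odd) (parts4 la) == 3%N)
                          && (count odd (parts4 la) == 1%N)].

Definition E1O3 (n : nat) : {set 4.-tuple 'I_n.+1} :=
  [set la in partitions4 n | (count (predC odd) (parts4 la) == 1%N)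
                          && (count odd (parts4 la) == 3%N)].

(* Main.v *)
Require Import Defs.
From mathcomp Require Import all_boot all_order all_algebra.
From mathcomp Require Import all_fingroup all_solvable all_field all_character.
From mathcomp Require Import zify ring.

Set Implicit Arguments.
Unset Strict Implicit.
Unset Printing Implicit Defensive.

Import Order.TTheory GRing.Theory Num.Theory.
Local Open Scope ring_scope.

(** The idea is Schur-Weyl duality. Let V be the natural representation of
    SL(2) and n = 2k+1. Then [k+1,k] is the multiplicity space of V in the
    n-th tensor power of V, so its square is the multiplicity space of
    V (x) V, for SL(2) x SL(2), in the n-th tensor power of the 4-dimensional
    space W = V (x) V. The image of SL(2) x SL(2) in GL(W) is SO(4), and the
    exchange of the two factors V is a reflection in O(4); hence the symmetric
    and the alternating part of the square are the multiplicity spaces of W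
    and of W (x) det for O(4). By duality for GL(W) the n-th tensor power of W
    is the sum of the [la] (x) S_la(W) over the partitions la of n with at
    most four parts, and W, respectively W (x) det, occurs in S_la(W) exactly
    when la is in E3O1, respectively in E1O3, and then once.

    The proof carries this out on character values, with tensor powers
    replaced by colourings of the n points and weights by contents. A class
    function of the form colour_sum phi sends g to the sum of phi (content F)
    over the colourings F that are constant on the cycles of g.

    Each [la] has this form (part_irr_colour_sum), by the Jacobi-Trudi
    formula: [la] is the alternating sum jt of the permutation characters on
    the colourings of content la_c - c + w(c). This virtual character has norm
    1 (jt_norm), because a sign-reversing cancellation (pieri_strip) leaves
    only the triangular part of a Kostka matrix. Of its terms only that of
    w = 1 has a constituent in common with the sign character induced from the
    Young subgroup of the conjugate partition (cfdot_jt_term,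
    cfdot_jt_term1), so jt is the common constituent that defines [la].

    The square of [k+1,k] at g is then a sum over pairs of 2-colourings, that
    is over 4-colourings (square_colour_sum). Its value at g^2 is the trace on
    a tensor power of W of g composed with the exchange of factors; since the
    exchange has eigenvalues 1, 1, 1, -1, this too is a sum over 4-colourings
    fixed by g (adams_colour_sum). The sums of [la] over E3O1 and E1O3 are a
    third such sum (sum_E3O1_E1O3). As the names of the four colours are
    immaterial, two such sums are equal as soon as their coefficients agree
    after symmetrisation over S_4 (eq_colour_sum_sym). The symmetrised
    coefficients depend only on the parities of the four numbers of points of
    each colour and on their differences up to 4, so finitely many contents
    remain, and these are evaluated (sides_agree_small). *)

(** * Colourings and their contents *)

Section Colourings.

Variables (n : nat) (C : finType).
Implicit Types (F : {ffun 'I_n -> C}) (s g : 'S_n) (phi : {ffun C -> nat} -> algC).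

Definition content F : {ffun C -> nat} := [ffun c => #|[set i | F i == c]|].

Definition recolour F s : {ffun 'I_n -> C} := [ffun i => F (s i)].

Definition stab F := [set s : 'S_n | recolour F s == F].

(** A colouring is stabilised by g exactly when it is constant on the cycles of g;
    so this is the value at g of the combination, with coefficients phi mu, of
    the permutation characters on the colourings of content mu. *)
Definition colour_sum phi g : algC := \sum_(F | g \in stab F) phi (content F).

Lemma recolourM F s t : recolour F (s * t)%g = recolour (recolour F t) s.
Proof. by apply/ffunP=> i; rewrite !ffunE permM. Qed.

Lemma recolour1 F : recolour F 1%g = F.
Proof. by apply/ffunP=> i; rewrite ffunE perm1. Qed.

Lemma sum_content F : (\sum_c content F c)%N = n.
Proof.
rewrite -[RHS]card_ord -sum1_card.
rewrite (partition_big F predT) //=; apply: eq_bigr => c _.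
by rewrite ffunE -sum1_card; apply: eq_bigl => i; rewrite !inE.
Qed.

Lemma content_recolour F s : content (recolour F s) = content F.
Proof.
apply/ffunP=> c; rewrite !ffunE.
rewrite -(card_preimset [set i | F i == c] (@perm_inj _ s)).
by apply: eq_card => i; rewrite !inE ffunE.
Qed.

Lemma count_mktuple F c : count_mem c [tuple F i | i < n] = content F c.
Proof.
rewrite ffunE /= count_map -sum1_count -sum1_card big_enum_cond /=.
by apply: eq_bigl => i; rewrite !inE.
Qed.

Lemma eq_content_recolour F F' :
  content F = content F' -> exists s, F' = recolour F s.
Proof.
move=> eqF.
have: perm_eq [tuple F' i | i < n] [tuple F i | i < n].
  by apply/allP=> c _; rewrite /= !(count_mktuple _ c) eqF.
case/tuple_permP=> s /val_inj/eqP; rewrite eqEtuple => /forallP Es.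
exists s; apply/ffunP=> i; rewrite ffunE.
by have /eqP := Es i; rewrite !tnth_mktuple.
Qed.

Lemma exists_content (mu : {ffun C -> nat}) :
  (\sum_c mu c)%N = n -> exists F, content F = mu.
Proof.
move=> mu_n; pose s := flatten [seq nseq (mu c) c | c <- enum C].
have size_s : size s == n.
  rewrite size_flatten /shape -map_comp (eq_map (fun=> size_nseq _ _)).
  by rewrite sumnE big_map -mu_n big_enum.
exists [ffun i => tnth (Tuple size_s) i]; apply/ffunP=> c.
rewrite -count_mktuple.
have ->: [tuple [ffun i => tnth (Tuple size_s) i] i | i < n] = Tuple size_s.
  by apply: eq_from_tnth => i; rewrite tnth_mktuple ffunE.
rewrite /= count_flatten -map_comp sumnE big_map big_enum /= (bigD1 c) //=.
rewrite count_nseq /= eqxx mul1n big1 ?addn0 // => d /negPf d_c.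
by rewrite count_nseq /= d_c.
Qed.

(** Contents classify the orbits of S_n on colourings, and the permutations that
    carry F to F' form a coset of the stabiliser of F. *)
Lemma card_recolour F F' :
  #|[set s | recolour F s == F']| = ((content F' == content F) * #|stab F|)%N.
Proof.
case: eqP => [eqF | neqF]; last first.
  rewrite mul0n; apply/eqP; rewrite cards_eq0; apply/eqP/setP=> s.
  by rewrite !inE; apply/negP=> /eqP eqF; case: neqF; rewrite -eqF content_recolour.
have [t ->] := eq_content_recolour (esym eqF).
rewrite mul1n -(card_lcoset (stab F) t); apply: eq_card => s.
rewrite mem_lcoset !inE recolourM; apply/eqP/eqP=> [-> | {2}<-].
  by rewrite -recolourM mulVg recolour1.
by rewrite -recolourM mulgV recolour1.
Qed.

Lemma card_stab_content F F' : content F = content F' -> #|stab F| = #|stab F'|.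
Proof.
move=> eqF.
have /esym := card_recolour F F'; rewrite eqF eqxx mul1n => ->.
have /esym := card_recolour F' F; rewrite eqF eqxx mul1n => ->.
rewrite -(card_imset _ invg_inj); apply: eq_card => s.
rewrite inE -{1}[s]invgK mem_imset ?inE; last exact: invg_inj.
by apply/eqP/eqP=> <-; rewrite -recolourM ?mulVg ?mulgV recolour1.
Qed.

(** Burnside counting: exchanging the sums weights each colouring by the order
    of its stabiliser, so every orbit, that is every content, contributes n!.
    Entries of a content are at most n, hence any alphabet 'I_B with n < B
    enumerates them all. *)
Lemma sum_colour_sum phi B : (n < B)%N ->
  \sum_(g : 'S_n) colour_sum phi g =
  n`!%:R * \sum_(mu : {ffun C -> 'I_B} | (\sum_c mu c)%N == n)
              phi [ffun c => mu c : nat].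
Proof.
move=> lt_nB; have lt_content F c : (content F c < B)%N.
  apply: leq_ltn_trans lt_nB; rewrite ffunE -[leqRHS]card_ord; exact: max_card.
pose bc F := [ffun c => Ordinal (lt_content F c)] : {ffun C -> 'I_B}.
have bcE F : [ffun c => bc F c : nat] = content F.
  by apply/ffunP=> c; rewrite !ffunE.
rewrite /colour_sum (exchange_big_dep predT) //= mulr_sumr.
rewrite (partition_big bc (fun mu => (\sum_c mu c)%N == n)) /= => [|F _].
  apply: eq_bigr => mu /eqP mu_n.
  (* F0 is a base point of the orbit of colourings of content mu. *)
  have [|F0 F0mu] := @exists_content [ffun c => mu c : nat].
    by rewrite -[RHS]mu_n; apply: eq_bigr => c _; rewrite ffunE.
  have bcP F : (bc F == mu) = (content F == content F0).
    apply/eqP/eqP=> [bc_mu | eqF]; first by rewrite F0mu -bc_mu bcE.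
    by apply/ffunP=> c; apply/val_inj; rewrite ffunE /= eqF F0mu ffunE.
  transitivity (\sum_(F | bc F == mu) #|[set s | recolour F0 s == F]|%:R
                  * phi [ffun c => mu c : nat]).
    apply: eq_bigr => F; rewrite bcP => /eqP eqF.
    by rewrite sumr_const card_recolour eqF eqxx mul1n (card_stab_content eqF)
               F0mu mulr_natl.
  rewrite -mulr_suml; congr (_ * _); rewrite -natr_sum -card_Sn -sum1_card.
  rewrite (partition_big (recolour F0) (fun F => bc F == mu)) /= => [|s _].
    congr _%:R; apply: eq_bigr => F _; rewrite -sum1_card.
    by apply: eq_bigl => s; rewrite inE.
  by rewrite bcP content_recolour.
by rewrite -[X in _ == X](sum_content F); apply/eqP; apply: eq_bigr => c _; rewrite ffunE.
Qed.

End Colourings.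

(** * Characters induced from Young subgroups *)

Section YoungSubgroups.

Variables (n N : nat).
Implicit Types (a b la : seq nat) (F : {ffun 'I_n -> 'I_N}) (g s : 'S_n).

Definition entries a : {ffun 'I_N -> nat} := [ffun c : 'I_N => nth 0%N a c].

(** The Young subgroup of a is the stabiliser of the colouring of each point by
    the index of its block. *)
Lemma block_colouring a : size a = N -> sumn a = n ->
  exists F0, [/\ forall i, F0 i = reshape_index a i :> nat,
                 young_set n a = stab F0 & content F0 = entries a].
Proof.
move=> size_a sum_a.
have ltN (i : 'I_n) : (reshape_index a i < N)%N.
  by rewrite -size_a reshape_indexP ?sum_a.
pose F0 := [ffun i => Ordinal (ltN i)]; exists F0; split=> [i||].
- by rewrite ffunE.
- apply/setP=> s; rewrite !inE; apply/forallP/eqP=> [Hs | Hs i].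
    by apply/ffunP=> i; apply/val_inj; rewrite !ffunE /=; apply/eqP.
  by have /ffunP/(_ i)/(congr1 val)/eqP := Hs; rewrite !ffunE.
apply/ffunP=> c; rewrite !ffunE.
have ltn (r : 'I_(nth 0%N a c)) : (flatten_index a c r < n)%N.
  by rewrite -sum_a flatten_indexP.
pose f r := Ordinal (ltn r).
have f_inj : injective f.
  move=> r r' /(congr1 val)/(congr1 (reshape_offset a)) /=.
  by rewrite !flatten_indexKr // => /val_inj.
rewrite -[RHS]card_ord -(card_imset _ f_inj); apply: eq_card => i.
rewrite inE ffunE; apply/eqP/imsetP=> [ci | [r _ ->]]; last first.
  by apply/val_inj; rewrite /= flatten_indexKl.
have lt_off : (reshape_offset a i < nth 0%N a c)%N.
  by rewrite -ci reshape_offsetP ?sum_a.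
exists (Ordinal lt_off) => //; apply/val_inj.
by rewrite /= -{1}[i : nat](reshape_indexK a) -ci.
Qed.

(** Inducing the trivial character from the stabiliser of a colouring gives the
    permutation character on the orbit of that colouring. *)
Lemma cfInd_youngE a g : size a = N -> sumn a = n ->
  'Ind[[set: 'S_n]] (1 : 'CF(young_group n a)) g
    = colour_sum (fun al => (al == entries a)%:R) g.
Proof.
move=> size_a sum_a; have [F0 [_ YF0 F0a]] := block_colouring size_a sum_a.
rewrite cfIndE ?subsetT // /=; apply: (canLR (mulKf (neq0CG _))) => /=.
rewrite /colour_sum mulr_sumr [RHS]big_mkcond /=.
rewrite (partition_big (recolour F0) predT) //=.
apply: eq_bigr => F _.
transitivity (\sum_(s | recolour F0 s == F) (g \in stab F)%:R : algC).
  apply: eq_big => [s | s /= /andP[_ /eqP <-]]; first by rewrite inE.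
  rewrite cfun1E [_ \in young_group _ _]/= YF0 !inE conjgE !recolourM.
  congr (nat_of_bool _)%:R; apply/eqP/eqP=> [{2}<- | ->].
    by rewrite -[RHS]recolourM mulgV recolour1.
  by rewrite -recolourM mulVg recolour1.
rewrite sumr_const -cardsE card_recolour F0a YF0.
case: (g \in stab F); last by rewrite mul0rn.
by case: eqP => _; rewrite ?mulr1 ?mulr0 ?mul1n.
Qed.

Definition block_inj b F :=
  [forall i : 'I_n, forall j : 'I_n,
    (reshape_index b i == reshape_index b j) && (F i == F j) ==> (i == j)].

Lemma block_injP b F :
  reflect (forall i j : 'I_n, reshape_index b i = reshape_index b j -> F i = F j -> i = j)
          (block_inj b F).
Proof.
apply: (iffP 'forall_'forall_implyP) => [H i j Eb EF | H i j /andP[/eqP Eb /eqP EF]].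
  by apply/eqP/H; rewrite Eb EF !eqxx.
by apply/eqP/H.
Qed.

(** Two points of one block with the same colour can be transposed without
    leaving the subgroup, and this reverses all signs; when there are no such
    points, the identity alone is left. *)
Lemma sum_sign_stab b F :
  \sum_(s in young_set n b | s \in stab F) (-1) ^+ s = (block_inj b F)%:R :> algC.
Proof.
have [/block_injP injF | ] := boolP (block_inj b F).
  rewrite (big_pred1 1%g) ?odd_perm1 // => s; rewrite !inE.
  apply/andP/eqP=> [[/forallP bs /eqP/ffunP Fs] | ->]; last first.
    by rewrite recolour1; split=> //; apply/forallP=> i; rewrite perm1.
  apply/permP=> i; rewrite perm1; apply: injF; first exact/eqP.
  by have := Fs i; rewrite ffunE.
rewrite negb_forall => /existsP[i]; rewrite negb_forall => /existsP[j].
rewrite negb_imply => /andP[/andP[/eqP Eb /eqP EF] neq_ij].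
have bt k : reshape_index b (tperm i j k) = reshape_index b k by case: tpermP => // ->.
have Ft k : F (tperm i j k) = F k by case: tpermP => // ->.
set S := \sum_(s in _ | _) _; have: S = - S.
  rewrite {1}/S (reindex_inj (mulIg (tperm i j))) /= -sumrN.
  apply: eq_big => [s | s _]; last first.
    by rewrite odd_permM odd_tperm neq_ij addbT signrN.
  rewrite !inE; congr (_ && _).
    by apply: eq_forallb => k; rewrite permM bt.
  by congr (_ == _); apply/ffunP=> k; rewrite !ffunE permM Ft.
by move/eqP; rewrite -addr_eq0 -mulr2n mulrn_eq0 => /eqP.
Qed.

(** By Frobenius reciprocity the product is an average over the Young subgroup,
    and sum_sign_stab evaluates the part of each colouring. *)
Lemma cfdot_Ind_sgn b (psi : 'CF([set: 'S_n])) phi :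
    (forall g, psi g = colour_sum phi g) ->
  '[psi, 'Ind[[set: 'S_n]] ('Res[young_group n b] (@cfSgn n))] =
  #|young_group n b|%:R^-1 * \sum_(F | block_inj b F) phi (content F).
Proof.
move=> psiE; rewrite -cfdot_Res_l cfdotE; congr (_ * _).
transitivity (\sum_(g in young_set n b) \sum_(F | g \in stab F)
                phi (content F) * (-1) ^+ g).
  apply: eq_bigr => g Yg; rewrite !cfResE ?subsetT // psiE !cfunE rmorph_sign.
  by rewrite mulr_suml.
rewrite (exchange_big_dep predT) //= [RHS]big_mkcond /=; apply: eq_bigr => F _.
by rewrite -mulr_sumr sum_sign_stab; case: ifP; rewrite ?mulr1 ?mulr0.
Qed.

End YoungSubgroups.

(** * Colourings by pairs *)

Section PairColours.

Variables (n : nat) (C D : finType).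
Implicit Type H : {ffun 'I_n -> C * D}.

Definition fst_col H : {ffun 'I_n -> C} := [ffun i => (H i).1].
Definition snd_col H : {ffun 'I_n -> D} := [ffun i => (H i).2].

Definition row_sums (mu : {ffun C * D -> nat}) : {ffun C -> nat} :=
  [ffun c => (\sum_d mu (c, d))%N].
Definition col_sums (mu : {ffun C * D -> nat}) : {ffun D -> nat} :=
  [ffun d => (\sum_c mu (c, d))%N].

Lemma content_fst H : content (fst_col H) = row_sums (content H).
Proof.
apply/ffunP=> c; rewrite !ffunE -sum1_card (partition_big (snd_col H) predT) //=.
apply: eq_bigr => d _; rewrite ffunE -sum1_card; apply: eq_bigl => i.
by rewrite !inE !ffunE.
Qed.

Lemma content_snd H : content (snd_col H) = col_sums (content H).
Proof.
apply/ffunP=> d; rewrite !ffunE -sum1_card (partition_big (fst_col H) predT) //=.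
apply: eq_bigr => c _; rewrite ffunE -sum1_card; apply: eq_bigl => i.
by rewrite !inE !ffunE andbC.
Qed.

Lemma colour_sumM (phi : {ffun C -> nat} -> algC)
    (psi : {ffun D -> nat} -> algC) (g : 'S_n) :
  colour_sum phi g * colour_sum psi g =
  colour_sum (fun mu => phi (row_sums mu) * psi (col_sums mu)) g.
Proof.
rewrite /colour_sum mulr_suml.
under eq_bigr do rewrite mulr_sumr.
rewrite pair_big_dep /=.
rewrite (reindex (fun H => (fst_col H, snd_col H))) /=; last first.
  exists (fun p : {ffun 'I_n -> C} * {ffun 'I_n -> D} => [ffun i => (p.1 i, p.2 i)]).
    by move=> H _; apply/ffunP=> i; rewrite !ffunE; case: (H i).
  by case=> F G _; congr (_, _); apply/ffunP=> i; rewrite !ffunE.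
apply: eq_big => [H | H _]; last by rewrite content_fst content_snd.
rewrite !inE; apply/andP/eqP=> [[/eqP/ffunP H1 /eqP/ffunP H2] | /ffunP HH].
  apply/ffunP=> i; have := H1 i; have := H2 i; rewrite !ffunE.
  by move=> E2 E1; rewrite [LHS]surjective_pairing E1 E2 -surjective_pairing.
by split; apply/eqP/ffunP=> i; have := HH i; rewrite !ffunE => ->.
Qed.

End PairColours.

(** * The Jacobi-Trudi virtual character of a partition *)

(** The first differing value of w would exceed its index, since the smaller
    values are already taken. *)
Lemma perm_prefix N (w : 'S_N) :
  (forall v : 'I_N, (\sum_(c : 'I_N | c <= v) w c <= \sum_(c : 'I_N | c <= v) c)%N) ->
  w = 1%g.
Proof.
move=> Hw; suff wE m (c : 'I_N) : (c <= m)%N -> w c = c.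
  by apply/permP=> c; rewrite perm1 (wE c).
elim: m c => [|m IHm] c le_cm.
all: have wlt (c' : 'I_N) : (c' < c)%N -> w c' = c' by move=> ?; apply: IHm || lia; lia.
all: have := Hw c; rewrite (bigD1 c) //= [X in (_ <= X)%N](bigD1 c) //=.
all: rewrite (eq_bigr (fun c' : 'I_N => val c')) => [|c' /andP[le_c'c c'Nc]];
  last by rewrite wlt // ltn_neqAle le_c'c andbT.
all: rewrite leq_add2r leq_eqVlt => /orP[/eqP/val_inj // | lt_wc].
all: by have /perm_inj E := wlt _ lt_wc; move: lt_wc; rewrite E ltnn.
Qed.

Lemma cfSgn_char n : cfSgn n \is a character.
Proof.
pose r (s : 'S_n) : 'M[algC]_1 := ((-1) ^+ s)%:M.
have r_repr : mx_repr [set: 'S_n] r.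
  by split=> [|s t _ _]; rewrite /r ?odd_perm1 // odd_permM signr_addb scalar_mxM.
suff ->: cfSgn n = cfRepr (MxRepresentation r_repr) by exact: cfRepr_char.
by apply/cfun_inP=> s _; rewrite cfunE cfRepr1E || rewrite !cfunE inE mulr1n mxtrace_scalar.
Qed.

Section JacobiTrudi.

Variables (n N : nat) (la : seq nat).
Hypotheses (size_la : size la = N) (sum_la : sumn la = n).

(** Equality of al_c with la_c - c + w(c), written without subtraction because
    the latter number may be negative. *)
Definition jt_rel (w : 'S_N) (al : {ffun 'I_N -> nat}) :=
  [forall c : 'I_N, al c + c == nth 0%N la c + w c]%N.

(** The contents in the expansion of the Jacobi-Trudi determinant, whose entry
    in row c and column j is the complete symmetric function of degree
    la_c - c + j, with their signs. *)
Definition jt_weight (al : {ffun 'I_N -> nat}) : algC :=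
  \sum_(w : 'S_N) (-1) ^+ w * (jt_rel w al)%:R.

Definition jt_parts (w : 'S_N) := [seq (nth 0 la (c : 'I_N) + w c - c)%N | c <- enum 'I_N].

(** A term of the determinant with a factor of negative degree is zero. *)
Definition jt_term (w : 'S_N) : 'CF([set: 'S_n]) :=
  if [forall c : 'I_N, c <= nth 0%N la c + w c]%N
  then 'Ind (1 : 'CF(young_group n (jt_parts w))) else 0.

Definition jt : 'CF([set: 'S_n]) := \sum_(w : 'S_N) (-1) ^+ w *: jt_term w.

Lemma jt_partsE w (c : 'I_N) : nth 0%N (jt_parts w) c = (nth 0 la c + w c - c)%N.
Proof. by rewrite (nth_map c) ?nth_ord_enum // size_enum_ord. Qed.

Lemma sum_nth_la : (\sum_(c < N) nth 0 la c)%N = n.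
Proof. by rewrite -sum_la sumnE (big_nth 0%N) size_la big_mkord. Qed.

Lemma jt_termE w g : jt_term w g =
  colour_sum (fun al => (jt_rel w al)%:R) g.
Proof.
rewrite /jt_term; case: ifP => [/forallP ok | /negbT].
  rewrite (@cfInd_youngE n N); first last.
  - apply: (@addIn (\sum_(c < N) c)%N).
    rewrite sumnE big_map big_enum -big_split /=.
    under eq_bigr => c _ do rewrite subnK ?ok //.
    rewrite big_split /= sum_nth_la; congr (_ + _)%N.
    by rewrite [RHS](reindex_inj (@perm_inj _ w)).
  - by rewrite size_map size_enum_ord.
  apply: eq_bigr => F _; congr (nat_of_bool _)%:R.
  apply/eqP/forallP => [-> c | H].
    by rewrite ffunE jt_partsE subnK ?ok.
  apply/ffunP=> c; rewrite [RHS]ffunE jt_partsE.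
  by rewrite -(eqP (H c)) addnK.
rewrite negb_forall => /existsP[c Hc]; rewrite cfunE /colour_sum big1 // => F _.
case: (boolP (jt_rel w (content F))) => // /forallP/(_ c)/eqP E.
by case/negP: Hc; rewrite -E leq_addl.
Qed.

Lemma jtE g : jt g = colour_sum jt_weight g.
Proof.
rewrite /jt sum_cfunE /colour_sum /jt_weight (exchange_big_dep predT) //=.
apply: eq_bigr => w _; rewrite cfunE jt_termE /colour_sum mulr_sumr.
by apply: eq_bigl => F; rewrite andbT.
Qed.

Lemma jt_term_char w : jt_term w \is a character.
Proof. by rewrite /jt_term; case: ifP; rewrite ?rpred0 ?cfInd_char ?rpred1. Qed.

Lemma jt_vchar : (jt \in 'Z[irr [set: 'S_n]])%g.
Proof. by apply: rpred_sum => w _; rewrite rpredZsign char_vchar ?jt_term_char. Qed.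

Hypothesis sorted_la : sorted geq la.

Lemma la_geq i j : (i <= j)%N -> (nth 0%N la j <= nth 0%N la i)%N.
Proof.
move=> le_ij; have [lt_j | ge_j] := ltnP j (size la); last by rewrite (nth_default _ ge_j).
apply: (@sorted_leq_nth _ geq _ _ 0%N la) => //; rewrite ?inE ?(leq_ltn_trans le_ij) //.
by move=> x y z le_xy le_yz; apply: leq_trans le_yz le_xy.
by move=> x /=.
Qed.

Lemma la_leq i : (nth 0%N la i <= n)%N.
Proof.
have [lt_i | ge_i] := ltnP i N; last by rewrite nth_default ?size_la.
by rewrite -sum_nth_la (bigD1 (Ordinal lt_i)) //= leq_addr.
Qed.

Lemma size_conj_part : size (conj_part la) = n.
Proof. by rewrite size_map size_iota sum_la. Qed.

Lemma nth_conj_part (r : 'I_n) :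
  nth 0%N (conj_part la) r = (\sum_(c < N) (r < nth 0%N la c))%N.
Proof.
rewrite (nth_map 0%N) ?size_iota ?sum_la // nth_iota ?sum_la // add0n.
rewrite -sum1_count big_mkcond (big_nth 0%N) size_la big_mkord.
by apply: eq_bigr => c _; case: ifP.
Qed.

Lemma sum_ltn_ord m : (m <= n)%N -> (\sum_(r < n) (r < m))%N = m.
Proof.
move=> le_mn; rewrite -big_mkcond /= sum1_card.
have widen_inj : injective (widen_ord le_mn) by move=> r r' /(congr1 val) /= /val_inj.
rewrite -[RHS]card_ord -(card_imset _ widen_inj); apply: eq_card => r.
apply/idP/imsetP=> [lt_rm | [r' _ ->]]; last by rewrite unfold_in /=; case: r'.
by exists (Ordinal lt_rm) => //; apply/val_inj.
Qed.

Lemma sumn_conj_part : sumn (conj_part la) = n.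
Proof.
rewrite sumnE (big_nth 0%N) size_conj_part big_mkord.
under eq_bigr do rewrite nth_conj_part.
rewrite exchange_big /= -[RHS]sum_nth_la; apply: eq_bigr => c _.
by rewrite sum_ltn_ord ?la_leq.
Qed.

(** Colour the points by the cells of the diagram of la, in such a way that the
    columns are the blocks of the Young subgroup of the conjugate partition;
    then the row of the cell is a colouring of content la, and two points of
    one column lie in different rows. *)
Lemma exists_block_inj :
  exists2 F : {ffun 'I_n -> 'I_N}, block_inj (conj_part la) F & content F = entries N la.
Proof.
have [F0 [F0E _ F0c]] := block_colouring size_conj_part sumn_conj_part.
pose mu := [ffun cr : 'I_N * 'I_n => (cr.2 < nth 0%N la cr.1)%N : nat].
have row_mu : row_sums mu = entries N la.
  by apply/ffunP=> c; rewrite !ffunE; under eq_bigr do rewrite ffunE /=;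
     rewrite sum_ltn_ord ?la_leq.
have col_mu : col_sums mu = entries n (conj_part la).
  by apply/ffunP=> r; rewrite !ffunE nth_conj_part; apply: eq_bigr => c _; rewrite ffunE.
have [|H HC] := @exists_content n _ mu.
  rewrite (eq_bigr (fun p => mu (p.1, p.2))) => [|[] //].
  rewrite -(pair_bigA _ (fun c r => mu (c, r))) /= -[RHS]sum_nth_la.
  by apply: eq_bigr => c _; have /ffunP/(_ c) := row_mu; rewrite !ffunE.
have [|s F0s] := @eq_content_recolour _ _ (snd_col H) F0.
  by rewrite F0c content_snd HC.
exists (fst_col (recolour H s)); last by rewrite content_fst content_recolour HC.
apply/block_injP=> i j; rewrite -!F0E => /val_inj Eb EF.
have EH : recolour H s i = recolour H s j.
  rewrite [LHS]surjective_pairing [RHS]surjective_pairing; congr (_, _).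
    by move: EF; rewrite !ffunE.
  by move: Eb; rewrite F0s !ffunE.
have: (content (recolour H s) (recolour H s i) <= 1)%N.
  by rewrite content_recolour HC ffunE leq_b1.
rewrite ffunE => /card_le1_eqP; apply; rewrite inE //.
by rewrite EH.
Qed.

(** In each column at most min(v+1, height) points have one of the colours
    0, ..., v, and the cells of the diagram in the rows 0, ..., v attain this
    bound in every column. *)
Lemma block_inj_dominated (F : {ffun 'I_n -> 'I_N}) (v : 'I_N) :
  block_inj (conj_part la) F ->
  (\sum_(c : 'I_N | c <= v) content F c <= \sum_(c : 'I_N | c <= v) nth 0%N la c)%N.
Proof.
move=> /block_injP injF.
have [F0 [F0E _ F0c]] := block_colouring size_conj_part sumn_conj_part.
have ->: (\sum_(c : 'I_N | c <= v) content F c =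
          \sum_(r < n) #|[set i | (F i <= v) && (F0 i == r)]|)%N.
  transitivity #|[set i | F i <= v]|%N.
    rewrite -sum1_card (partition_big F (fun c : 'I_N => c <= v)%N) /=; last first.
      by move=> i; rewrite inE.
    apply: eq_bigr => c le_cv; rewrite ffunE -sum1_card; apply: eq_bigl => i.
    by rewrite !inE; case: eqP => [->|]; rewrite ?le_cv ?andbF.
  rewrite -sum1_card (partition_big F0 predT) //=.
  by apply: eq_bigr => r _; rewrite -sum1_card; apply: eq_bigl => i; rewrite !inE.
have ->: (\sum_(c : 'I_N | c <= v) nth 0 la c =
          \sum_(r < n) #|[set c : 'I_N | (c <= v) && (r < nth 0 la c)]|)%N.
  under [RHS]eq_bigr do rewrite -sum1_card big_mkcond /=.
  rewrite exchange_big /= big_mkcond; apply: eq_bigr => c _.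
  case: ifP => le_cv; last by rewrite big1 // => r _; rewrite inE le_cv.
  rewrite -{1}[nth 0%N la c]sum_ltn_ord ?la_leq //; apply: eq_bigr => r _.
  by rewrite inE le_cv; case: ltnP.
apply: leq_sum => r _.
(* If column r meets all the rows up to v, injectivity gives the bound v+1;
   otherwise the height of the column is the bound. *)
have [all_r | ] := boolP [forall c : 'I_N, (c <= v) ==> (r < nth 0%N la c)]%N.
  rewrite -(card_in_imset (f := F)); last first.
    move=> i j; rewrite !inE => /andP[_ /eqP Ei] /andP[_ /eqP Ej]; apply: injF.
    by rewrite -!F0E Ei Ej.
  apply/subset_leq_card/subsetP=> _ /imsetP[i + ->]; rewrite !inE => /andP[le_v _].
  by rewrite le_v (implyP (forallP all_r _)).
rewrite negb_forall => /existsP[c0]; rewrite negb_imply -leqNgt => /andP[le_c0 le_r].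
apply: leq_trans (_ : #|[set i | F0 i == r]| <= _)%N.
  by apply/subset_leq_card/subsetP=> i; rewrite !inE => /andP[].
have /ffunP/(_ r) := F0c; rewrite !ffunE nth_conj_part => ->.
rewrite -big_mkcond /= sum1_card; apply/subset_leq_card/subsetP=> c.
rewrite unfold_in => lt_r; rewrite inE andbC (lt_r : (r < nth 0 la c)%N) /=.
by rewrite leqNgt; apply/negP=> lt_vc; have := @la_geq c0 c; lia.
Qed.

Let E := 'Ind[[set: 'S_n]] ('Res[young_group n (conj_part la)] (@cfSgn n)).

(** A colouring that contributes would have content la_c - c + w(c); by
    dominance the prefix sums of w are then at most those of the identity. *)
Lemma cfdot_jt_term w : w != 1%g -> '[jt_term w, E] = 0.
Proof.
move=> w_n1; rewrite (cfdot_Ind_sgn _ (jt_termE w)) big1 ?mulr0 // => F injF.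
case: (boolP (jt_rel w (content F))) => // /forallP al.
case/eqP: w_n1; apply: perm_prefix => v.
have:= block_inj_dominated v injF.
rewrite -(leq_add2r (\sum_(c : 'I_N | c <= v) c)%N) -big_split /=.
under eq_bigr => c _ do rewrite (eqP (al c)).
by rewrite big_split /= leq_add2l.
Qed.

Lemma cfdot_jt_term1 : '[jt_term 1, E] != 0.
Proof.
rewrite (cfdot_Ind_sgn _ (jt_termE 1)) mulf_neq0 ?invr_eq0 ?neq0CG //.
have [F injF contF] := exists_block_inj.
rewrite (bigD1 F) //= contF.
have ->: jt_rel 1%g (entries N la).
  by apply/forallP=> c; rewrite ffunE perm1.
by rewrite gt_eqF // ltr_wpDr ?ltr01 ?sumr_ge0 // => ? _; rewrite ler0n.
Qed.

(** Any common constituent of the two characters that define [la] occurs in no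
    term of jt other than that of w = 1, as those are orthogonal to the
    induced sign character. Hence it has positive multiplicity in jt, which is
    irreducible up to sign. *)
Lemma part_irr_jt : '[jt] = 1 -> part_irr n la = jt.
Proof.
move=> norm_jt.
have term_la : jt_term 1 = 'Ind (1 : 'CF(young_group n la)).
  rewrite /jt_term; case: forallP => [_ | []].
    suff ->: jt_parts 1 = la by [].
    apply: (@eq_from_nth _ 0%N); first by rewrite size_map size_enum_ord.
    rewrite size_map size_enum_ord => i lt_i.
    by rewrite (jt_partsE 1 (Ordinal lt_i)) perm1 addnK.
  by move=> c; rewrite perm1 leq_addl.
have E_char : E \is a character.
  by rewrite cfInd_char ?cfRes_char ?cfSgn_char.
have common i : (i \in irr_constt (jt_term 1)) && (i \in irr_constt E) -> jt = 'chi_i.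
  case/andP=> i1 iE.
  have jt_i : '[jt, 'chi_i] = '[jt_term 1, 'chi_i].
    rewrite /jt cfdot_suml (bigD1 1%g) //= odd_perm1 scale1r big1 ?addr0 // => w w_n1.
    rewrite cfdotZl; apply/eqP; rewrite mulf_eq0 signr_eq0 /=.
    have ge0 v j : v \is a character -> 0 <= '[v, 'chi[[set: 'S_n]]_j].
      by move=> v_char; rewrite natr_ge0 ?Cnat_cfdot_char_irr.
    have /eqP := cfdot_jt_term w_n1; rewrite cfdot_char_r // psumr_eq0.
      move/allP/(_ i); rewrite mem_index_enum => /(_ isT); rewrite mulf_eq0.
      by rewrite irr_consttE in iE; rewrite (negPf iE) orbF.
    by move=> j _; rewrite mulr_ge0 ?ge0 ?jt_term_char.
  have [b [j jtj]] := vchar_norm1P jt_vchar norm_jt.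
  have: 0 < '[jt, 'chi_i].
    rewrite irr_consttE in i1.
    by rewrite jt_i lt_def i1 natr_ge0 // Cnat_cfdot_char_irr ?jt_term_char.
  rewrite jtj cfdotZl cfdot_irr; case: eqP => [-> | _]; last by rewrite mulr0 ltxx.
  by case: b {jtj}; rewrite ?scale1r // mulr1 oppr_gt0 ltr10.
rewrite /part_irr -term_la; case: pickP => [i /common -> // | none].
case/eqP: cfdot_jt_term1; rewrite cfdot_char_r // big1 // => i _.
by apply/eqP; rewrite mulf_eq0; have := none i; rewrite !irr_consttE; do 2 case: eqP.
Qed.

End JacobiTrudi.

(** * The Pieri rule by cancellation *)

Section Pieri.

Variables (N B : nat).
Local Notation V := {ffun 'I_N -> 'I_B}.
Implicit Types (m l : V) (D : V -> algC) (beta : nat -> nat).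

Definition rho (c : 'I_N) : nat := (N - c.+1)%N.

Definition permute_entries m (u : 'S_N) : V := [ffun c => m (u c)].

Definition antisymmetric D := forall u m, D (permute_entries m u) = (-1) ^+ u * D m.

(** With rho added, a partition becomes strictly decreasing. *)
Definition strict m := [forall i : 'I_N, forall j : 'I_N, (i < j)%N ==> (m j < m i)%N].

Definition below m l := [forall c : 'I_N, (m c <= l c)%N].

(** For strictly decreasing l, and together with below m l, this says that the
    two partitions obtained by subtracting rho differ by a horizontal strip. *)
Definition strip m l := [forall i : 'I_N, forall j : 'I_N, (i < j)%N ==> (l j < m i)%N].

Definition drop_by b l m := below m l && (\sum_c l c == \sum_c m c + b)%N.

Lemma strictP m : reflect (forall i j : 'I_N, (i < j)%N -> (m j < m i)%N) (strict m).
Proof. exact: (iffP 'forall_'forall_implyP). Qed.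

Lemma stripP m l : reflect (forall i j : 'I_N, (i < j)%N -> (l j < m i)%N) (strip m l).
Proof. exact: (iffP 'forall_'forall_implyP). Qed.

Lemma sum_permute m u : (\sum_c permute_entries m u c = \sum_c m c)%N.
Proof.
by rewrite [RHS](reindex_inj (@perm_inj _ u)); apply: eq_bigr => c _; rewrite ffunE.
Qed.

Lemma permute_entries_inj u : injective (permute_entries^~ u).
Proof.
move=> m m' /ffunP E; apply/ffunP=> c.
by have := E (u^-1 c)%g; rewrite !ffunE permKV.
Qed.

Lemma pieri_antisymmetric D b :
  antisymmetric D -> antisymmetric (fun l => \sum_(m | drop_by b l m) D m).
Proof.
move=> antiD u l; rewrite mulr_sumr (reindex_inj (@permute_entries_inj u)) /=.
apply: eq_big => [m | m _]; last exact: antiD.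
rewrite /drop_by !sum_permute; congr (_ && _).
apply/forallP/forallP=> H c; last by rewrite !ffunE.
by have := H (u^-1 c)%g; rewrite !ffunE permKV.
Qed.

(** Multiplying an antisymmetric expression by a complete symmetric function of
    degree b adds b to the exponents in all possible ways. At the first row i
    where the strip condition fails, both m_i and m_(i+1) are at most l_(i+1),
    so exchanging them is a sign-reversing involution. *)
Lemma pieri_strip D b l : antisymmetric D -> strict l ->
  \sum_(m | drop_by b l m) D m = \sum_(m | drop_by b l m && strip m l) D m.
Proof.
move=> antiD /strictP strict_l.
pose good t m := [forall i : 'I_N, forall j : 'I_N,
  (i < t)%N && (j == i.+1 :> nat) ==> (l j < m i)%N].
have goodP t m :
  reflect (forall i j : 'I_N, (i < t)%N -> j = i.+1 :> nat -> (l j < m i)%N) (good t m).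
  apply: (iffP 'forall_'forall_implyP) => [H i j lt_i Ej | H i j /andP[lt_i /eqP Ej]].
    by apply: H; rewrite lt_i Ej eqxx.
  exact: H.
(* good t m is the strip condition for the rows of index less than t; the terms whose first
   failure is in row t cancel, so t can be raised one row at a time. *)
suff cancel t : \sum_(m | drop_by b l m) D m = \sum_(m | drop_by b l m && good t m) D m.
  rewrite (cancel N); apply: eq_bigl => m; congr (_ && _).
  apply/goodP/stripP=> [H i j lt_ij | H i j _ Ej]; last by apply: H; rewrite Ej.
  have lt_iN : (i.+1 < N)%N by apply: leq_ltn_trans (ltn_ord j).
  apply: leq_ltn_trans (H i (Ordinal lt_iN) _ _) => //.
  have [E | neq] := eqVneq j (Ordinal lt_iN); first by rewrite E.
  by apply/ltnW/strict_l; rewrite /= ltn_neqAle lt_ij andbT eq_sym.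
elim: t => [|t ->].
  by apply: eq_bigl => m; rewrite [good 0%N m](introT (goodP _ _)) ?andbT.
have [lt_tN | ge_tN] := ltnP t.+1 N; last first.
  apply: eq_bigl => m; congr (_ && _); apply/goodP/goodP=> H i j lt_i Ej; apply: H => //.
    by have := ltn_ord j; lia.
  by lia.
pose i := Ordinal (ltnW lt_tN); pose j := Ordinal lt_tN.
have goodS m : good t.+1 m = good t m && (l j < m i)%N.
  apply/goodP/andP=> [H | [/goodP H lt_ji] i' j' lt_i' Ej'].
    by split; [apply/goodP=> i' j' lt_i'; apply: H; lia | apply: H].
  have [E | neq] := eqVneq i' i; last first.
    apply: H => //; have : (i' : nat) <> t by move=> E; case/eqP: neq; apply/val_inj.
    by lia.
  have -> : j' = j by apply/val_inj; rewrite /= Ej' E.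
  by rewrite E.
rewrite (bigID (fun m => (l j < m i)%N)) /=.
under eq_bigl do rewrite -andbA -goodS.
rewrite -[RHS]addr0; congr (_ + _).
set S := \sum_(m | _) _; suff: S = - S.
  by move/eqP; rewrite -addr_eq0 -mulr2n mulrn_eq0 => /eqP.
have neq_ij : i != j by rewrite -val_eqE /= neq_ltn ltnSn.
rewrite {1}/S (reindex_inj (@permute_entries_inj (tperm i j))) -sumrN.
apply: eq_big => [m | m _]; last by rewrite antiD odd_tperm neq_ij mulN1r.
have lt_l := strict_l i j (ltnSn t).
rewrite /drop_by sum_permute; set m' := permute_entries _ _.
have m'i : m' i = m j by rewrite ffunE tpermL.
have m'j : m' j = m i by rewrite ffunE tpermR.
have m'c c : c != i -> c != j -> m' c = m c by move=> ? ?; rewrite ffunE tpermD // eq_sym.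
have good' : good t m' = good t m.
  apply/goodP/goodP=> H i1 j1 lt_i1 Ej1; have := H i1 j1 lt_i1 Ej1;
    rewrite m'c // -val_eqE /=; lia.
rewrite good' m'i -!leqNgt.
case: (boolP (good t m)) => _; rewrite ?andbF //= !andbT.
case: eqP => _; rewrite ?andbF //= !andbT.
apply/andP/andP=> [[/forallP below_m le_m] | [/forallP below_m le_m]]; split.
- apply/forallP=> c; have [->|ci] := eqVneq c i.
    by rewrite -m'j (leq_trans (below_m j)) // ltnW.
  have [->|cj] := eqVneq c j; first by [].
  by rewrite -m'c.
- by rewrite -m'j.
- apply/forallP=> c; have [->|ci] := eqVneq c i.
    by rewrite m'i (leq_trans (below_m j)) // ltnW.
  have [->|cj] := eqVneq c j; first by rewrite m'j.
  by rewrite m'c.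
- exact: below_m.
Qed.

(** The coefficient of x^m in the Vandermonde determinant. *)
Definition det_rho m : algC :=
  \sum_(w : 'S_N) (-1) ^+ w * [forall c, m c == rho (w c) :> nat]%:R.

(** The coefficient of x^l in the product of the Vandermonde determinant and the
    complete symmetric functions of degrees beta 0, ..., beta (k-1). *)
Fixpoint pieri_sum beta k : V -> algC :=
  if k is k'.+1 then fun l => \sum_(m | drop_by (beta k') l m) pieri_sum beta k' m
  else det_rho.

Lemma det_rho_antisymmetric : antisymmetric det_rho.
Proof.
move=> u m; rewrite /det_rho mulr_sumr (reindex_inj (mulgI u)) /=.
apply: eq_bigr => w _; rewrite odd_permM signr_addb -mulrA; congr (_ * (_ * _%:R)).
congr nat_of_bool; apply/forallP/forallP=> H c; last by rewrite ffunE permM.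
by have := H (u^-1 c)%g; rewrite ffunE permM permKV.
Qed.

Lemma pieri_sum_antisymmetric beta k : antisymmetric (pieri_sum beta k).
Proof.
elim: k => [|k IHk]; first exact: det_rho_antisymmetric.
exact: pieri_antisymmetric.
Qed.

Lemma pieri_sumS beta k l : strict l ->
  pieri_sum beta k.+1 l =
  \sum_(m | drop_by (beta k) l m && strip m l) pieri_sum beta k m.
Proof. by move=> strict_l; apply: pieri_strip => //; apply: pieri_sum_antisymmetric. Qed.

Lemma strip_strict m l : below m l -> strip m l -> strict m.
Proof.
move=> /forallP le_ml /stripP lt_lm; apply/strictP=> i j lt_ij.
exact: leq_ltn_trans (le_ml j) (lt_lm i j lt_ij).
Qed.

Lemma det_rho_strict m : strict m -> det_rho m = [forall c, m c == rho c :> nat]%:R.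
Proof.
move=> /strictP strict_m; rewrite /det_rho (bigD1 1%g) //= odd_perm1 mul1r big1 ?addr0.
  by congr (nat_of_bool _)%:R; apply: eq_forallb => c; rewrite perm1.
move=> w w_n1; case: (boolP [forall c, _]) => [/forallP mw | _]; last by rewrite mulr0.
have wE c : m c = rho (w c) :> nat by apply/eqP.
have w_incr (i j : 'I_N) : (i < j)%N -> (w i < w j)%N.
  move=> /strict_m; rewrite !wE /rho; have := ltn_ord (w i); have := ltn_ord (w j); lia.
have le_w (c : 'I_N) : (c <= w c)%N.
  case: c => c lt_c; elim: c lt_c => // c IHc lt_c /=.
  apply: leq_ltn_trans (IHc (ltnW lt_c)) _; exact: w_incr.
case/eqP: w_n1; apply: invg_inj; rewrite invg1; apply: perm_prefix => v.
by apply: leq_sum => c _; have := le_w (w^-1 c)%g; rewrite permKV.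
Qed.

Local Notation prefix j f := (\sum_(c : 'I_N | c < j) f c)%N.

Lemma prefixS (k : 'I_N) (f : 'I_N -> nat) : prefix k.+1 f = (prefix k f + f k)%N.
Proof.
rewrite (bigD1 k) //= addnC; congr (_ + _)%N; apply: eq_bigl => c.
by rewrite ltnS ltn_neqAle andbC.
Qed.

Lemma sum_prefix j (f : 'I_N -> nat) :
  (\sum_c f c = prefix j f + \sum_(c : 'I_N | j <= c) f c)%N.
Proof.
rewrite (bigID (fun c : 'I_N => c < j)%N) /=; congr (_ + _)%N.
by apply: eq_bigl => c; rewrite -leqNgt.
Qed.

(** Each horizontal strip reaches at most one row further down than the previous
    one. So k strips stay in the first k rows, and the first j of them fit in
    the first j rows, which bounds their total size: a Kostka number vanishes
    unless its content is dominated by its shape. *)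
Lemma pieri_sum_support beta k m : (k <= N)%N -> strict m -> pieri_sum beta k m != 0 ->
  (forall c : 'I_N, (k <= c)%N -> m c = rho c :> nat) /\
  (forall j, (j <= k)%N -> (prefix j beta + prefix j rho <= prefix j m)%N).
Proof.
elim: k m => [|k IHk] m lt_kN strict_m.
  rewrite /= det_rho_strict //.
  case: (boolP [forall c, _]) => [/forallP mE _ | _]; last by rewrite eqxx.
  split=> [c _ | j]; first exact/eqP.
  by rewrite leqn0 => /eqP ->; rewrite !big1.
rewrite pieri_sumS // => nz.
have /existsP[m' /andP[/andP[/andP[le_m' /eqP sum_m'] strip_m'] nz']] :
    [exists m', drop_by (beta k) m m' && strip m' m && (pieri_sum beta k m' != 0)].
  apply: contraNT nz; rewrite negb_exists => /forallP none.
  rewrite big1 // => m' Pm'; apply/eqP; have := none m'; rewrite Pm' /=.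
  by rewrite negbK.
have [supp' pre'] := IHk m' (ltnW lt_kN) (strip_strict le_m' strip_m') nz'.
move/stripP in strip_m'; move/forallP in le_m'.
(* Row c has to stay below the old row c-1, which was still at rho. *)
have supp (c : 'I_N) : (k < c)%N -> m c = rho c :> nat.
  move=> lt_kc; pose c' := Ordinal (leq_ltn_trans (leq_pred c) (ltn_ord c)).
  have lt_c'c : (c' < c)%N by rewrite /=; lia.
  have := strip_m' c' c lt_c'c; have := le_m' c.
  rewrite !supp' /=; try lia; rewrite /rho /=; have := ltn_ord c; lia.
split=> // j; rewrite leq_eqVlt => /orP[/eqP -> | lt_jk]; last first.
  apply: leq_trans (pre' j lt_jk) _; apply: leq_sum => c _; exact: le_m'.
pose kk := Ordinal lt_kN; have := pre' k (leqnn k).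
rewrite !(prefixS kk) /=; have := sum_m'.
rewrite !(sum_prefix k.+1) !(prefixS kk).
have -> : (\sum_(c < N | k < c) m c = \sum_(c < N | k < c) m' c)%N.
  by apply: eq_bigr => c lt_kc; rewrite supp // supp' // ltnW.
have := supp' kk (leqnn _); rewrite /=; lia.
Qed.

(** The diagonal Kostka numbers are 1: when the sizes beta are the row lengths,
    the bound of pieri_sum_support forces every strip to be a full row. *)
Lemma pieri_sum_one beta k m : (k <= N)%N -> strict m ->
  (forall c : 'I_N, (c < k)%N -> m c = (rho c + beta c)%N :> nat) ->
  (forall c : 'I_N, (k <= c)%N -> m c = rho c :> nat) ->
  pieri_sum beta k m = 1.
Proof.
elim: k m => [|k IHk] m lt_kN strict_m mlt mge.
  rewrite /= det_rho_strict //; case: forallP => // -[] c; exact/eqP/mge.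
pose kk := Ordinal lt_kN.
have lt_rho : (rho kk < B)%N.
  by apply: leq_ltn_trans (ltn_ord (m kk)); rewrite mlt // leq_addr.
(* The only possible last step adds row k to what is below. *)
pose m0 : V := [ffun c => if c == kk then Ordinal lt_rho else m c].
have m0k : m0 kk = rho kk :> nat by rewrite ffunE eqxx.
have m0c c : c != kk -> m0 c = m c by rewrite ffunE => /negPf ->.
have below0 : below m0 m.
  apply/forallP=> c; have [-> | /m0c -> //] := eqVneq c kk.
  by rewrite m0k mlt ?leq_addr.
have strip0 : strip m0 m.
  apply/stripP=> i j lt_ij.
  have [E | /m0c ->] := eqVneq i kk; last exact: (strictP _ strict_m).
  move: lt_ij; rewrite E m0k => lt_kj; rewrite mge // /rho /=.
  by move: lt_kj => /=; have := ltn_ord j; lia.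
rewrite pieri_sumS // (bigD1 m0) /=; last first.
  rewrite /drop_by below0 strip0 andbT (bigD1 kk) // [X in _ == X + _](bigD1 kk) //=.
  have -> : (\sum_(c < N | c != kk) m0 c = \sum_(c < N | c != kk) m c)%N.
    by apply: eq_bigr => c /m0c ->.
  by rewrite m0k mlt //= addnAC eqxx.
rewrite big1 ?addr0 => [|m' /andP[/andP[/andP[le_m' sum_m'] strip_m'] m'_neq]].
  apply: IHk => [|| c lt_c | c]; first exact: ltnW; first exact: strip_strict strip0.
    by rewrite m0c ?mlt //; [lia | rewrite -val_eqE /=; lia].
  have [-> // | c_neq le_kc] := eqVneq c kk.
  by rewrite m0c // mge //; move: c_neq; rewrite -val_eqE /=; lia.
apply/eqP; apply: contraNT m'_neq => nz.
have [supp' pre'] := pieri_sum_support (ltnW lt_kN) (strip_strict le_m' strip_m') nz.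
move/forallP in le_m'.
have sum_eq : prefix k m' = prefix k m.
  apply/eqP; rewrite eqn_leq; apply/andP; split; first exact: leq_sum.
  apply: leq_trans (pre' k (leqnn k)); rewrite -big_split /=.
  by apply: leq_sum => c lt_c; rewrite (mlt c) 1?addnC // (ltn_trans lt_c).
apply/eqP/ffunP=> c; apply/val_inj; have [-> | c_neq] := eqVneq c kk.
  by rewrite /= m0k supp' /=.
rewrite m0c //; have [lt_ck | le_kc] := ltnP c k.
  apply/eqP; rewrite eqn_leq le_m' /=.
  move: sum_eq; rewrite (bigD1 c) // [RHS](bigD1 c) //=.
  set X := (X in (_ + X)%N = _); set Y := (X in _ = (_ + X)%N).
  have : (X <= Y)%N by exact: leq_sum.
  lia.
rewrite /= supp' // mge //; move: c_neq; rewrite -val_eqE /=; lia.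
Qed.

End Pieri.

(** * Matrices with prescribed column sums *)

Section MatrixSums.

Variables (N B : nat).
Local Notation V := {ffun 'I_N -> 'I_B}.
Implicit Types (m v : V) (beta : nat -> nat).

(** Matrices are built column by column; the last column is the one that
    pieri_sum removes first. *)
Definition ffun_rcons (T : Type) k (f : {ffun 'I_k -> T}) (x : T) : {ffun 'I_k.+1 -> T} :=
  [ffun j => oapp f x (unlift ord_max j)].

Lemma ffun_rcons_widen T k (f : {ffun 'I_k -> T}) x j :
  ffun_rcons f x (widen_ord (leqnSn k) j) = f j.
Proof.
have -> : widen_ord (leqnSn k) j = lift ord_max j by apply/val_inj/esym/lift_max.
by rewrite ffunE liftK.
Qed.

Lemma ffun_rcons_last T k (f : {ffun 'I_k -> T}) x : ffun_rcons f x ord_max = x.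
Proof. by rewrite ffunE unlift_none. Qed.

Lemma big_ffun_recr (R : nmodType) (T : finType) k (P : pred {ffun 'I_k.+1 -> T})
    (F : {ffun 'I_k.+1 -> T} -> R) :
  \sum_(f | P f) F f =
  \sum_x \sum_(f : {ffun 'I_k -> T} | P (ffun_rcons f x)) F (ffun_rcons f x).
Proof.
rewrite pair_big_dep /=.
rewrite (reindex (fun p : T * {ffun 'I_k -> T} => ffun_rcons p.2 p.1)) //=.
exists (fun f => (f ord_max, [ffun j => f (widen_ord (leqnSn k) j)])).
  by case=> x f _ /=; congr (_, _); [rewrite ffun_rcons_last |
     apply/ffunP=> j; rewrite ffunE ffun_rcons_widen].
move=> f _ /=; apply/ffunP=> j; rewrite ffunE.
case: unliftP => [j' ->|->] //=; rewrite ffunE; congr (f _).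
by apply/val_inj/esym/lift_max.
Qed.

(** The column mu j is the choice of a monomial in the complete symmetric
    function of degree beta j. *)
Definition matrix_sum beta k m : algC :=
  \sum_(mu : {ffun 'I_k -> V} | [forall j, \sum_c mu j c == beta j]%N)
  \sum_(w : 'S_N) (-1) ^+ w * [forall c, m c == \sum_j mu j c + rho (w c) :> nat]%N%:R.

(** The involution that exchanges a last column v with the remainder m - v. *)
Definition sub_fun m v : V :=
  [ffun c => Ordinal (leq_ltn_trans (leq_subr (v c) (m c)) (ltn_ord (m c)))].

Lemma matrix_sumE beta k m : matrix_sum beta k m = pieri_sum beta k m.
Proof.
elim: k m => [|k IHk] m.
  rewrite /matrix_sum (big_pred1 [ffun=> m]) => [|mu] /=; last first.
    by apply/forallP/eqP=> [_ | _ []//]; apply/ffunP=> -[].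
  apply: eq_bigr => w _; congr (_ * (nat_of_bool _)%:R).
  by apply: eq_forallb => c; rewrite big_ord0.
rewrite /matrix_sum big_ffun_recr /=.
rewrite [RHS](reindex_onto (sub_fun m) (sub_fun m)) => [|m' /andP[/forallP le_m' _]];
  last first.
  by apply/ffunP=> c; apply/val_inj; rewrite !ffunE /= subKn ?le_m'.
rewrite [RHS](eq_bigl (fun v => below v m && (\sum_c v c == beta k)%N)); last first.
  move=> v.
  apply/andP/andP=> [[/andP[_ /eqP sum_m] /eqP/ffunP subK] | [/forallP le_v /eqP sum_v]].
    have le_v : below v m.
      by apply/forallP=> c; rewrite -subK !ffunE /= leq_subr.
    split=> //; move: sum_m.
    have -> : (\sum_c m c = \sum_c sub_fun m v c + \sum_c v c)%N.
      rewrite -big_split; apply: eq_bigr => c _.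
      by rewrite /= ffunE /= subnK ?(forallP le_v).
    by move/addnI->.
  split; last by apply/eqP/ffunP=> c; apply/val_inj; rewrite !ffunE /= subKn ?le_v.
  apply/andP; split; first by apply/forallP=> c; rewrite ffunE leq_subr.
  by rewrite -sum_v -big_split; apply/eqP/eq_bigr => c _; rewrite /= ffunE /= subnK.
rewrite [RHS]big_mkcond; apply: eq_bigr => v _.
have [le_v | nle_v] := boolP (below v m); last first.
  rewrite big1 // => mu _; rewrite big1 // => w _.
  case: (boolP [forall c, _]) => [/forallP mE | _]; last by rewrite mulr0.
  case/negP: nle_v; apply/forallP=> c; rewrite (eqP (mE c)) big_ord_recr /= ffun_rcons_last.
  by rewrite -addnA addnCA leq_addr.
have condE (mu : {ffun 'I_k -> V}) : [forall j, \sum_c ffun_rcons mu v j c == beta j]%N =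
    (\sum_c v c == beta k)%N && [forall j, \sum_c mu j c == beta j]%N.
  apply/forallP/andP=> [H | [Hv /forallP H] j].
    split; first by have := H ord_max; rewrite ffun_rcons_last.
    by apply/forallP=> j; have := H (widen_ord (leqnSn k) j); rewrite ffun_rcons_widen.
  by rewrite ffunE; case: unliftP => [j' ->|->] //=; rewrite /bump leqNgt ltn_ord add0n.
under eq_bigl do rewrite condE.
case: (_ == beta k); last by rewrite big_pred0_eq.
rewrite -IHk; apply: eq_bigr => mu _; apply: eq_bigr => w _; congr (_ * (nat_of_bool _)%:R).
apply: eq_forallb => c; rewrite big_ord_recr /= ffun_rcons_last.
under eq_bigr do rewrite ffun_rcons_widen.
rewrite ffunE /=; have := forallP le_v c; set S := (\sum_i _)%N.
by move=> le_vc; apply/eqP/eqP; lia.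
Qed.

End MatrixSums.

(** * Irreducibility of the Jacobi-Trudi character *)

Section Norm.

Variables (n N : nat) (la : seq nat).
Hypotheses (size_la : size la = N) (sum_la : sumn la = n) (sorted_la : sorted geq la).

Let B := (n + N).+1.

Lemma shifted_lt (c : 'I_N) : (nth 0%N la c + rho c < B)%N.
Proof. by rewrite ltnS leq_add ?(la_leq size_la sum_la) // leq_subr. Qed.

(** The strictly decreasing sequence la + rho. *)
Definition shifted : {ffun 'I_N -> 'I_B} := [ffun c => Ordinal (shifted_lt c)].

Lemma shifted_strict : strict shifted.
Proof.
apply/strictP=> i j lt_ij; rewrite !ffunE /rho /=.
have := la_geq sorted_la (ltnW lt_ij); have := ltn_ord j; lia.
Qed.

Lemma jt_weight_conj (al : {ffun 'I_N -> nat}) : (jt_weight la al)^* = jt_weight la al.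
Proof.
rewrite rmorph_sum; apply: eq_bigr => w _.
by rewrite rmorphM rmorph_sign; congr (_ * _); rewrite rmorph_nat.
Qed.

Lemma colour_sum_conj (C : finType) (phi : {ffun C -> nat} -> algC) (g : 'S_n) :
  (forall al, (phi al)^* = phi al) -> (colour_sum phi g)^* = colour_sum phi g.
Proof. by move=> conj_phi; rewrite rmorph_sum; apply: eq_bigr => F _; apply: conj_phi. Qed.

(** This is the inner product of jt with its own term of index w. It is the
    coefficient of x^(la + rho) in the Vandermonde determinant times the
    complete symmetric functions of degrees la_d - d + w(d); these degrees
    dominate la, strictly unless w = 1. *)
Lemma sum_jt_rows (w : 'S_N) :
  \sum_(mu : {ffun 'I_N * 'I_N -> 'I_B} | (\sum_c mu c)%N == n)
     jt_weight la (row_sums [ffun c => mu c : nat])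
       * (jt_rel la w (col_sums [ffun c => mu c : nat]))%:R
  = (w == 1%g)%:R.
Proof.
have [/forallP ok | ] := boolP [forall d : 'I_N, d <= nth 0%N la d + w d]%N; last first.
  rewrite negb_forall => /existsP[d Hd].
  have w_n1 : w != 1%g by apply: contraNneq Hd => ->; rewrite perm1 leq_addl.
  rewrite (negPf w_n1) big1 // => mu _.
  case: (boolP (jt_rel la w _)) => [/forallP/(_ d)/eqP E | _]; last by rewrite mulr0.
  by case/negP: Hd; rewrite -E leq_addl.
pose beta j := (nth 0 la j + oapp (fun d : 'I_N => w d : nat) 0 (insub j) - j)%N.
have betaE (d : 'I_N) : (beta d + d = nth 0 la d + w d)%N.
  by rewrite /beta valK /= subnK.
transitivity (pieri_sum beta N shifted); last first.
  have [w1 | w_n1] := eqVneq w 1%g.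
    apply: pieri_sum_one => // [|c _|c]; first exact: shifted_strict.
      by rewrite ffunE /= addnC; have := betaE c; rewrite w1 perm1 => /addIn ->.
    by rewrite leqNgt ltn_ord.
  apply/eqP; apply: contraNT w_n1 => nz.
  have [_ pre] := pieri_sum_support (leqnn N) shifted_strict nz.
  apply/eqP/perm_prefix=> v; have := pre v.+1 (ltn_ord v).
  rewrite -(leq_add2r (\sum_(c < N | c < v.+1) c)%N).
  rewrite addnAC -big_split /=.
  under eq_bigr do rewrite betaE.
  under [X in (_ <= X + _)%N -> _]eq_bigr do rewrite ffunE /=.
  rewrite !big_split /=.
  set R := (\sum_(c < N | _) rho c)%N; set L := (\sum_(c < N | _) nth 0 la c)%N.
  set W := (\sum_(c < N | _) w c)%N; set I := (\sum_(c < N | _) c)%N.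
  lia.
rewrite -matrix_sumE /matrix_sum.
pose curry (mu : {ffun 'I_N -> {ffun 'I_N -> 'I_B}}) : {ffun 'I_N * 'I_N -> 'I_B} :=
  [ffun cd => mu cd.2 cd.1].
have curry_bij : bijective curry.
  exists (fun mu : {ffun 'I_N * 'I_N -> 'I_B} => [ffun d => [ffun c => mu (c, d)]]).
    by move=> mu; apply/ffunP=> d; apply/ffunP=> c; rewrite !ffunE.
  by move=> mu; apply/ffunP=> -[c d]; rewrite !ffunE.
rewrite (reindex curry) /=; last exact: onW_bij.
rewrite big_mkcond [RHS]big_mkcond; apply: eq_bigr => mu _.
have colE d : col_sums [ffun c => curry mu c : nat] d = (\sum_c mu d c)%N.
  by rewrite ffunE; apply: eq_bigr => c _; rewrite !ffunE.
have rowE c : row_sums [ffun c => curry mu c : nat] c = (\sum_d mu d c)%N.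
  by rewrite ffunE; apply: eq_bigr => d _; rewrite !ffunE.
have relE : jt_rel la w (col_sums [ffun c => curry mu c : nat]) =
            [forall d, \sum_c mu d c == beta d]%N.
  by apply: eq_forallb => d; rewrite colE -betaE eqn_add2r.
rewrite relE.
case: (boolP [forall d, _]) => [/forallP cols | _]; last by rewrite mulr0 if_same.
have -> : (\sum_c curry mu c == n)%N.
  rewrite (eq_bigr (fun p => val (curry mu (p.1, p.2)))) => [|[] //].
  rewrite -(pair_bigA _ (fun c d => val (curry mu (c, d)))) exchange_big /=.
  apply/eqP/(@addIn (\sum_(d < N) d)%N).
  rewrite -big_split /=.
  under eq_bigr => d _.
    under eq_bigr do rewrite ffunE /=.
    rewrite (eqP (cols d)) betaE; over.
  rewrite big_split /= (sum_nth_la size_la sum_la); congr (_ + _)%N.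
  by rewrite [RHS](reindex_inj (@perm_inj _ w)).
rewrite mulr1; apply: eq_bigr => v _; congr (_ * (nat_of_bool _)%:R).
apply: eq_forallb => c; rewrite rowE ffunE /= /rho.
have := ltn_ord c; have := ltn_ord (v c); set S := (\sum_d _)%N.
by move=> ? ?; apply/eqP/eqP; lia.
Qed.

(** By Burnside counting the inner product is a sum over contents of colourings
    by pairs, that is over matrices; expanding the weight of the column sums
    leaves the contribution of w = 1. *)
Lemma jt_norm : '[jt n N la] = 1.
Proof.
rewrite cfdotE cardsT card_Sn; apply: (canLR (mulKf _)).
  by rewrite pnatr_eq0 -lt0n fact_gt0.
rewrite mulr1.
under eq_bigr => g _.
  rewrite !jtE // (colour_sum_conj _ jt_weight_conj) colour_sumM; over.
rewrite (eq_bigl predT) => [|g]; last by rewrite inE.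
rewrite (@sum_colour_sum n _ _ B) ?ltnS ?leq_addr //.
rewrite -[RHS]mulr1; congr (_ * _).
transitivity (\sum_(w : 'S_N) (-1) ^+ w * (w == 1%g)%:R : algC).
  under [RHS]eq_bigr do rewrite -sum_jt_rows mulr_sumr.
  rewrite exchange_big /=; apply: eq_bigr => mu _.
  rewrite {2}/jt_weight mulr_sumr; apply: eq_bigr => w _.
  by rewrite mulrCA.
rewrite (bigD1 1%g) //= odd_perm1 eqxx mul1r big1 ?addr0 // => w /negPf ->.
by rewrite mulr0.
Qed.

Lemma part_irrE : part_irr n la = jt n N la.
Proof. by apply: part_irr_jt => //; apply: jt_norm. Qed.

Lemma part_irr_colour_sum g : part_irr n la g = colour_sum (jt_weight (N := N) la) g.
Proof. by rewrite part_irrE jtE. Qed.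

End Norm.

(** * Traces on tensor powers *)

Section TensorTrace.

Variables (n : nat) (C : finType) (R : comNzRingType) (g : 'S_n).
Implicit Types A M : C -> C -> R.

(** The trace, on the n-th tensor power of the free module with basis C, of the
    n-th power of the endomorphism with matrix A composed with the permutation
    g of the factors. *)
Definition tensor_trace A : R := \sum_(F : {ffun 'I_n -> C}) \prod_i A (F i) (F (g i)).

Definition kernel_mul A M c e := \sum_d A c d * M d e.

(** Permutations of the factors commute with tensor powers, so the trace is
    invariant under cyclic exchange. *)
Lemma tensor_traceC A M :
  tensor_trace (kernel_mul A M) = tensor_trace (kernel_mul M A).
Proof.
have traceE A1 A2 : tensor_trace (kernel_mul A1 A2) =
    \sum_(F : {ffun 'I_n -> C}) \sum_(G : {ffun 'I_n -> C})
      (\prod_i A1 (F i) (G i)) * \prod_i A2 (G i) (F (g i)).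
  apply: eq_bigr => F _; rewrite bigA_distr_bigA /=; apply: eq_bigr => G _.
  by rewrite big_split.
rewrite !traceE exchange_big; apply: eq_bigr => G _ /=.
have recolour_inj : injective (fun F : {ffun 'I_n -> C} => recolour F g).
  by move=> F F' /(congr1 (fun F => recolour F g^-1)); rewrite -!recolourM mulVg !recolour1.
rewrite [RHS](reindex_inj recolour_inj); apply: eq_bigr => F _ /=.
rewrite mulrC; congr (_ * _); first by apply: eq_bigr => i _; rewrite ffunE.
by rewrite [LHS](reindex_inj (@perm_inj _ g)); apply: eq_bigr => i _; rewrite ffunE.
Qed.

Lemma prod_if_forall (I : finType) (P : pred I) (h : I -> R) :
  \prod_i (if P i then h i else 0) = if [forall i, P i] then \prod_i h i else 0.
Proof.
case: forallP => [allP | notP]; first by apply: eq_bigr => i _; rewrite allP.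
have [i nPi] : exists i, ~~ P i by apply/existsP; rewrite -negb_forall; apply/forallP.
by rewrite (bigD1 i) //= (negPf nPi) mul0r.
Qed.

Lemma prod_content (h : C -> R) (F : {ffun 'I_n -> C}) :
  \prod_i h (F i) = \prod_c h c ^+ content F c.
Proof.
rewrite (partition_big F predT) //=; apply: eq_bigr => c _.
rewrite (eq_bigr (fun=> h c)) => [|i /eqP -> //].
by rewrite prodr_const ffunE cardsE.
Qed.

(** A diagonal matrix forces F to be constant on the cycles of g. *)
Lemma tensor_trace_diag (h : C -> R) :
  tensor_trace (fun c d => if c == d then h c else 0) =
  \sum_(F : {ffun 'I_n -> C} | g \in stab F) \prod_c h c ^+ content F c.
Proof.
rewrite [RHS]big_mkcond; apply: eq_bigr => F _.
rewrite prod_if_forall -prod_content; congr (if _ then _ else _).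
rewrite inE; apply/forallP/eqP=> [H | /ffunP H i]; last by rewrite -{1}H ffunE.
by apply/ffunP=> i; rewrite ffunE (eqP (H i)).
Qed.

End TensorTrace.

(** * The value of a 2-coloured sum at a square *)

Section Swap.

Variables (n : nat) (g : 'S_n).
Local Notation C2 := (bool * bool)%type.
Local Notation R := {poly algC}.

(** The exchange of the factors of a tensor square of a 2-dimensional space,
    with a variable recording how often the second basis vector occurs. *)
Definition swap_kernel (p q : C2) : R :=
  if (p.2 == q.1) && (p.1 == q.2) then 'X^(p.1 + p.2) else 0.

(** On the span of the two mixed basis vectors the exchange is diagonal in the
    basis of their sum, indexed by (false, true), and their difference, indexed
    by (true, false). *)
Definition swap_eigenbasis (p q : C2) : R :=
  match p, q with
  | (false, false), (false, false) | (true, true), (true, true) => 1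
  | (false, true), (false, true) | (false, true), (true, false)
  | (true, false), (false, true) => 1
  | (true, false), (true, false) => -1
  | _, _ => 0
  end.

Definition swap_eigenvalue (p : C2) : R :=
  match p with
  | (false, false) => 1 | (true, true) => 'X^2
  | (false, true) => 'X | (true, false) => - 'X
  end.

(** The diagonal matrix times the inverse of swap_eigenbasis, so that the two
    products with swap_eigenbasis are the exchange and its diagonal form. *)
Definition swap_half (p q : C2) : R :=
  (if p.1 == p.2 then 1 else 2%:R^-1%:P) * swap_eigenvalue p * swap_eigenbasis p q.

Lemma big_C2 (F : C2 -> R) :
  \sum_p F p = F (false, false) + F (false, true) + F (true, false) + F (true, true).
Proof.
rewrite (eq_bigr (fun p => F (p.1, p.2))) => [|[] //].
by rewrite -(pair_bigA _ (fun a b => F (a, b))) /= !big_bool /=; ring.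
Qed.

Lemma half_poly : 2%:R^-1%:P + 2%:R^-1%:P = 1 :> R.
Proof. by rewrite -polyCD -mulr2n -(mulr_natr 2%:R^-1) mulVf ?pnatr_eq0. Qed.

Lemma swap_kernelE p q : swap_kernel p q = kernel_mul swap_eigenbasis swap_half p q.
Proof.
rewrite /kernel_mul big_C2 /swap_kernel /swap_half.
have hE := half_poly; set h := 2%:R^-1%:P in hE *.
case: p q => [[] []] [[] []] /=; ring: hE.
Qed.

Lemma swap_diagE p q :
  (if p == q then swap_eigenvalue p else 0) = kernel_mul swap_half swap_eigenbasis p q.
Proof.
rewrite /kernel_mul big_C2 /swap_half.
have hE := half_poly; set h := 2%:R^-1%:P in hE *.
case: p q => [a b] [c d]; rewrite xpair_eqE.
case: a; case: b; case: c; case: d => /=; try ring: hE.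
by transitivity (- 'X * (h + h) : R); [rewrite hE mulr1 | ring].
Qed.

(** A colouring by pairs P contributes when P (g i) is P i reversed; then P i is
    (f i, f (g i)) for a colouring f with f (g (g i)) = f i. Each point of
    colour true is recorded twice, in P at the point and at its preimage. *)
Lemma trace_swap_kernel :
  tensor_trace g swap_kernel =
  \sum_(f : {ffun 'I_n -> bool} | (g ^+ 2)%g \in stab f) 'X^(2 * content f true).
Proof.
pose graph (f : {ffun 'I_n -> bool}) : {ffun 'I_n -> C2} := [ffun i => (f i, f (g i))].
rewrite /tensor_trace; under eq_bigr do rewrite prod_if_forall.
rewrite -big_mkcond (reindex_onto graph (@fst_col _ _ _)) /=; last first.
  move=> P /forallP swapP; apply/ffunP=> i; have /andP[/eqP E _] := swapP i.
  by rewrite !ffunE -E -surjective_pairing.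
apply: eq_big => [f | f /andP[_ _]].
  have -> : fst_col (graph f) == f by apply/eqP/ffunP=> i; rewrite !ffunE.
  rewrite andbT inE; apply/forallP/eqP=> [H | /ffunP H i].
    by apply/ffunP=> i; have /andP[_] := H i; rewrite !ffunE /= => /eqP ->; rewrite permM.
  by rewrite !ffunE eqxx /= -{1}(H i) !ffunE permM.
rewrite prodrXr; congr ('X^_).
rewrite (eq_bigr (fun i => f i + f (g i))%N) => [|i _]; last by rewrite ffunE.
have sum_fg : (\sum_i f (g i) = \sum_i f i)%N by rewrite [RHS](reindex_inj (@perm_inj _ g)).
rewrite big_split /= sum_fg addnn -mul2n.
congr (2 * _)%N; rewrite ffunE -sum1_card big_mkcond [RHS]big_mkcond /=.
by apply: eq_bigr => i _; rewrite !inE; case: (f i).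
Qed.

(** The trace of g composed with the exchange is computed in the given basis,
    where it counts 2-colourings fixed by g^2, and in an eigenbasis, where it
    is a signed sum over 4-colourings fixed by g; coefficients of X^(2m) are
    compared. *)
Lemma colour_sum_square (m : nat) :
  colour_sum (fun al : {ffun bool -> nat} => (al true == m)%:R) (g ^+ 2)%g =
  colour_sum (fun al : {ffun C2 -> nat} => (-1) ^+ al (true, false) *
    (al (false, true) + al (true, false) + 2 * al (true, true) == 2 * m)%N%:R) g.
Proof.
transitivity (tensor_trace g swap_kernel)`_(2 * m).
  rewrite trace_swap_kernel coef_sum; apply: eq_bigr => f _.
  by rewrite coefXn eqn_mul2l eq_sym.
have -> : tensor_trace g swap_kernel =
    tensor_trace g (kernel_mul swap_eigenbasis swap_half).
  by apply: eq_bigr => F _; apply: eq_bigr => i _; apply: swap_kernelE.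
rewrite tensor_traceC.
have -> : tensor_trace g (kernel_mul swap_half swap_eigenbasis) =
    tensor_trace g (fun p q => if p == q then swap_eigenvalue p else 0).
  by apply: eq_bigr => F _; apply: eq_bigr => i _; rewrite swap_diagE.
rewrite tensor_trace_diag coef_sum; apply: eq_bigr => F _.
have -> : \prod_c swap_eigenvalue c ^+ content F c =
    ((-1) ^+ content F (true, false))%:P *
      'X^(content F (false, true) + content F (true, false) + 2 * content F (true, true)).
  rewrite (eq_bigr (fun p => swap_eigenvalue (p.1, p.2) ^+ content F (p.1, p.2)))
    => [|[] //].
  rewrite -(pair_bigA _ (fun a b => swap_eigenvalue (a, b) ^+ content F (a, b))) /=.
  rewrite !big_bool /= expr1n mulr1 [(- 'X) ^+ _]exprNn -exprM !exprD polyC_exp polyCN.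
  by ring.
by rewrite coefCM coefXn eq_sym.
Qed.

End Swap.

(** * Renaming the colours *)

Lemma colour_sum_bij n (C D : finType) (h : C -> D) (h' : D -> C)
    (phi : {ffun D -> nat} -> algC) (g : 'S_n) :
  cancel h h' -> cancel h' h ->
  colour_sum phi g = colour_sum (fun al : {ffun C -> nat} => phi [ffun d => al (h' d)]) g.
Proof.
move=> hK h'K; rewrite /colour_sum.
rewrite (reindex (fun F : {ffun 'I_n -> C} => [ffun i => h (F i)])) /=; last first.
  exists (fun F : {ffun 'I_n -> D} => [ffun i => h' (F i)]) => F _;
    by apply/ffunP=> i; rewrite !ffunE ?hK ?h'K.
apply: eq_big => [F | F _].
  rewrite !inE; apply/eqP/eqP=> /ffunP H; apply/ffunP=> i; have := H i; rewrite !ffunE.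
    by move/(can_inj hK).
  by move->.
congr phi; apply/ffunP=> d; rewrite !ffunE; apply: eq_card => i.
by rewrite !inE ffunE (can2_eq hK h'K).
Qed.

Lemma eq_colour_sum n (C : finType) (phi psi : {ffun C -> nat} -> algC) (g : 'S_n) :
  (forall al : {ffun C -> nat}, (\sum_c al c)%N = n -> phi al = psi al) ->
  colour_sum phi g = colour_sum psi g.
Proof. by move=> eq_phi; apply: eq_bigr => F _; rewrite eq_phi ?sum_content. Qed.

(** Renaming the colours permutes the colourings fixed by g, so a coefficient
    function may be replaced by its average over all renamings. *)
Lemma eq_colour_sum_sym n N (phi psi : {ffun 'I_N -> nat} -> algC) (g : 'S_n) :
  (forall al : {ffun 'I_N -> nat}, (\sum_c al c)%N = n ->
     \sum_(u : 'S_N) phi [ffun c => al (u c)] = \sum_(u : 'S_N) psi [ffun c => al (u c)]) ->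
  colour_sum phi g = colour_sum psi g.
Proof.
move=> eq_sym.
have symE chi : N`!%:R * colour_sum chi g =
    colour_sum (fun al : {ffun 'I_N -> nat} => \sum_(u : 'S_N) chi [ffun c => al (u c)]) g.
  transitivity (\sum_(u : 'S_N) colour_sum chi g).
    by rewrite sumr_const card_Sn mulr_natl.
  rewrite [RHS](exchange_big_dep predT) //=.
  apply: eq_bigr => u _; rewrite (colour_sum_bij chi g (permKV u) (permK u)).
  by apply: eq_bigl => F; rewrite andbT.
apply: (@mulfI _ N`!%:R); first by rewrite pnatr_eq0 -lt0n fact_gt0.
by rewrite !symE; apply: eq_colour_sum.
Qed.

(** The permutations of 'I_N as explicit words, with their parities, by the value
    at 0: the finite set of permutations itself does not evaluate. *)
Fixpoint signed_perms N : seq (bool * seq nat) :=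
  if N is N'.+1 then
    [seq (odd j (+) p.1, j :: map (bump j) p.2) | j <- iota 0 N, p <- signed_perms N']
  else [:: (false, [::])].

Definition perm_word N (s : 'S_N) := [seq val (s i) | i <- enum 'I_N].

Lemma nth_perm_word N (s : 'S_N) (i : 'I_N) : nth 0%N (perm_word s) i = s i.
Proof. by rewrite (nth_map i) ?size_enum_ord // nth_ord_enum. Qed.

Lemma big_signed_perms (R : nmodType) N (F : bool -> seq nat -> R) :
  \sum_(s : 'S_N) F (odd_perm s) (perm_word s) = \sum_(p <- signed_perms N) F p.1 p.2.
Proof.
elim: N F => [|N IHN] F.
  rewrite /= big_seq1 (big_pred1 1%g) => [|s]; last by rewrite /= [s]permS0 eq_refl.
  by rewrite odd_perm1 /perm_word enum_ord0.
rewrite /signed_perms -/(signed_perms N) big_allpairs_dep /=.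
pose lp (p : 'I_N.+1 * 'S_N) := lift_perm ord0 p.1 p.2.
have lp_inj : injective lp.
  case=> j s [j' s'] E; have Ej : j = j'.
    by have /permP/(_ ord0) := E; rewrite /lp !lift_perm_id.
  congr (_, _) => //; apply/permP=> i.
  have /permP/(_ (lift ord0 i)) := E; rewrite /lp !lift_perm_lift /= Ej; exact: lift_inj.
have lp_bij : bijective lp.
  by apply: inj_card_bij lp_inj _; rewrite card_prod card_ord !card_Sn.
rewrite (reindex lp) /=; last exact: onW_bij.
rewrite (eq_bigr (fun p : 'I_N.+1 * 'S_N => F (odd p.1 (+) odd_perm p.2)
    (val p.1 :: map (bump p.1) (perm_word p.2)))) => [|[j s] _ /=]; last first.
  rewrite odd_lift_perm /=; congr F.
  rewrite /perm_word enum_ordSl /= lift_perm_id -!map_comp; congr (_ :: _).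
  by apply: eq_map => i /=; rewrite lift_perm_lift.
rewrite -(pair_bigA _ (fun (j : 'I_N.+1) (s : 'S_N) => F (odd j (+) odd_perm s)
    (val j :: map (bump j) (perm_word s)))) /=.
rewrite [RHS](_ : _ = \sum_(0 <= j < N.+1)
    \sum_(p <- signed_perms N) F (odd j (+) p.1) (j :: map (bump j) p.2)); last first.
  by rewrite /index_iota subn0.
rewrite big_mkord; apply: eq_bigr => j _.
exact: (IHN (fun e p => F (odd j (+) e) (val j :: map (bump j) p))).
Qed.

(** * The symmetrised coefficients for four colours *)

Section FiniteCheck.

Implicit Types (a b p : seq nat).

Definition permute_word a p := [seq nth 0%N a i | i <- p].

(** That a_c + c - p_c is weakly decreasing in c, without subtraction. It is then
    a partition, the last entry being nonnegative because p_3 is at most 3. *)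
Definition is_partition_shift a p :=
  [&& nth 0%N a 1 + 1 + nth 0%N p 0 <= nth 0%N a 0 + nth 0%N p 1,
      nth 0%N a 2 + 2 + nth 0%N p 1 <= nth 0%N a 1 + 1 + nth 0%N p 2 &
      nth 0%N a 3 + 3 + nth 0%N p 2 <= nth 0%N a 2 + 2 + nth 0%N p 3]%N.

(** The number of odd a_c + c - p_c; adding p_c instead keeps the parity. *)
Definition odd_shifts a p :=
  (odd (nth 0%N a 0 + nth 0%N p 0) + odd (nth 0%N a 1 + 1 + nth 0%N p 1) +
   odd (nth 0%N a 2 + 2 + nth 0%N p 2) + odd (nth 0%N a 3 + 3 + nth 0%N p 3))%N.

Definition parity_weight (eps : int) (m : nat) : int :=
  if m == 1%N then 1 else if m == 3%N then eps else 0.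

(** The coefficient of the content a in the sum of the [la] over E3O1 plus eps
    times their sum over E1O3: given a and the permutation p of the
    Jacobi-Trudi expansion, la_c must be a_c + c - p_c. *)
Definition partition_side (eps : int) a : int :=
  foldr +%R 0
    [seq (if is_partition_shift a sp.2 then
            (-1) ^+ nat_of_bool sp.1 * parity_weight eps (odd_shifts a sp.2) else 0)
    | sp <- signed_perms 4].

(** The coefficient of the content a in the square of [k+1,k], where the colours
    0, 1, 2, 3 are the pairs of colours 00, 01, 10, 11. It is written with the
    differences a_0 - a_3 and a_1 - a_2, which determine it. *)
Definition square_side a : int :=
  if nth 0%N a 0 == (nth 0%N a 3 + 1)%N then (nth 0%N a 1 == nth 0%N a 2 + 0)%N%:R
  else if nth 0%N a 0 == (nth 0%N a 3 + 2)%N then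
    - ((nth 0%N a 1 == nth 0%N a 2 + 1)%N || (nth 0%N a 2 == nth 0%N a 1 + 1)%N)%:R
  else if nth 0%N a 0 == (nth 0%N a 3 + 3)%N then (nth 0%N a 1 == nth 0%N a 2 + 0)%N%:R
  else 0.

(** The coefficient of the content a in the value of [k+1,k] at g^2. Colour 2
    stands for the eigenvector of the exchange with eigenvalue -1. *)
Definition adams_side a : int :=
  (-1) ^+ odd (nth 0%N a 2) *
  ((nth 0%N a 0 == nth 0%N a 3 + 1)%N%:R - (nth 0%N a 0 == nth 0%N a 3 + 3)%N%:R).

Definition symmetrise (f : seq nat -> int) a : int :=
  foldr +%R 0 [seq f (permute_word a sp.2) | sp <- signed_perms 4].

Definition sides_agree a :=
  (symmetrise square_side a == symmetrise (partition_side 1) a) &&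
  (symmetrise adams_side a == symmetrise (partition_side (-1)) a).

Definition of_gaps d x y z := [:: d + x + y + z; d + x + y; d + x; d]%N.

(** Decreasing contents with gaps below 6 and last entry 0 or 1 represent all
    contents up to same_shape. *)
Lemma sides_agree_small :
  all (fun d => all (fun x => all (fun y => all (fun z =>
    odd (sumn (of_gaps d x y z)) ==> sides_agree (of_gaps d x y z))
  (iota 0 6)) (iota 0 6)) (iota 0 6)) (iota 0 2).
Proof. by vm_compute. Qed.

(** What square_side, adams_side and partition_side depend on. The bound 4 is the
    largest difference that the inequalities of is_partition_shift compare
    with. *)
Definition same_shape a b := forall i j, (i < 4)%N -> (j < 4)%N ->
  odd (nth 0%N a i) = odd (nth 0%N b i) /\
  minn (nth 0%N a i - nth 0%N a j) 4 = minn (nth 0%N b i - nth 0%N b j) 4.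

Lemma signed_perms4P :
  all (fun sp => [&& size sp.2 == 4, sumn sp.2 == 6 & all (gtn 4) sp.2])%N (signed_perms 4).
Proof. by []. Qed.

Lemma eqn_shape a b i j t : same_shape a b -> (i < 4)%N -> (j < 4)%N -> (t < 4)%N ->
  (nth 0 a i == nth 0 a j + t)%N = (nth 0 b i == nth 0 b j + t)%N.
Proof.
move=> sh lt_i lt_j lt_t.
have [_ Eij] := sh i j lt_i lt_j; have [_ Eji] := sh j i lt_j lt_i.
by apply/eqP/eqP; lia.
Qed.

Lemma leq_shape a b i j s t : same_shape a b -> (i < 4)%N -> (j < 4)%N ->
    (s <= t + 4)%N -> (t < s + 4)%N ->
  (nth 0 a j + s <= nth 0 a i + t)%N = (nth 0 b j + s <= nth 0 b i + t)%N.
Proof.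
move=> sh lt_i lt_j le_st le_ts.
have [_ Eij] := sh i j lt_i lt_j; have [_ Eji] := sh j i lt_j lt_i.
by apply/idP/idP; lia.
Qed.

Lemma square_side_shape a b : same_shape a b -> square_side a = square_side b.
Proof.
move=> sh; rewrite /square_side !(eqn_shape sh) //.
Qed.

Lemma adams_side_shape a b : same_shape a b -> adams_side a = adams_side b.
Proof.
move=> sh; rewrite /adams_side !(eqn_shape sh) //.
by rewrite (proj1 (sh 2 2 _ _)%N).
Qed.

Lemma partition_side_shape eps a b :
  same_shape a b -> partition_side eps a = partition_side eps b.
Proof.
move=> sh; have shodd i hi := proj1 (sh i i hi hi).
congr foldr; apply/eq_in_map => sp /(allP signed_perms4P) /and3P[/eqP size_p _ /allP lt_p].
have lt i : (i < 4)%N -> (nth 0%N sp.2 i < 4)%N.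
  by rewrite -{1}size_p => lt_i; apply/lt_p/mem_nth.
have -> : odd_shifts a sp.2 = odd_shifts b sp.2.
  by rewrite /odd_shifts !oddD !shodd.
suff -> : is_partition_shift a sp.2 = is_partition_shift b sp.2 by [].
have := (lt 0 isT, lt 1 isT, lt 2 isT, lt 3 isT)%N => -[[[lt0 lt1] lt2] lt3].
rewrite /is_partition_shift -!addnA; congr [&& _, _ & _]; apply: leq_shape => //; lia.
Qed.

Lemma permute_word_shape a b p : all (gtn 4) p -> size p = 4%N ->
  same_shape a b -> same_shape (permute_word a p) (permute_word b p).
Proof.
move=> /allP lt_p size_p sh i j lt_i lt_j.
have lt k : (k < 4)%N -> (nth 0%N p k < 4)%N.
  by rewrite -{1}size_p => lt_k; apply/lt_p/mem_nth.
by rewrite !(nth_map 0%N) ?size_p //; apply: sh; apply: lt.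
Qed.

Lemma symmetrise_shape f a b : (forall a b, same_shape a b -> f a = f b) ->
  same_shape a b -> symmetrise f a = symmetrise f b.
Proof.
move=> f_sh sh; congr foldr; apply/eq_in_map => sp.
move=> /(allP signed_perms4P) /and3P[/eqP size_p _ lt_p].
by apply/f_sh/permute_word_shape.
Qed.

Lemma sides_agree_sorted (a0 a1 a2 a3 : nat) : (a3 <= a2)%N -> (a2 <= a1)%N -> (a1 <= a0)%N ->
  odd (a0 + a1 + a2 + a3) -> sides_agree [:: a0; a1; a2; a3].
Proof.
move=> le32 le21 le10 odd_a.
(* A gap of at least 4 is replaced with 4 or 5, according to its parity. *)
pose cl x := if (x < 4)%N then x else (4 + odd x)%N.
have lt_cl x : (cl x < 6)%N.
  rewrite /cl; case: (ltnP x 4) => [lt_x4 | _]; last by case: (odd x).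
  by apply: leq_trans lt_x4 _.
have odd_cl x : odd (cl x) = odd x by rewrite /cl; case: (ltnP x 4) => // _; case: (odd x).
have min_cl x : (x < 4)%N /\ cl x = x \/ (4 <= x)%N /\ (4 <= cl x)%N.
  by rewrite /cl; case: (ltnP x 4); [left | right; split; rewrite ?leq_addr].
pose b := of_gaps (odd a3) (cl (a2 - a3)%N) (cl (a1 - a2)%N) (cl (a0 - a1)%N).
have sh : same_shape [:: a0; a1; a2; a3] b.
  have := (min_cl (a2 - a3)%N, min_cl (a1 - a2)%N, min_cl (a0 - a1)%N).
  move=> [[m1 m2] m3] i j lt_i lt_j; split.
    case: i lt_i => [|[|[|[|//]]]] _ /=; rewrite ?oddD ?odd_cl ?oddB // ?oddb;
    by case: (odd a0); case: (odd a1); case: (odd a2); case: (odd a3).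
  set A := odd a3; move: m1 m2 m3; rewrite /b /of_gaps -/A.
  set x := cl (a2 - a3)%N; set y := cl (a1 - a2)%N; set z := cl (a0 - a1)%N.
  case: i lt_i => [|[|[|[|//]]]] _; case: j lt_j => [|[|[|[|//]]]] _ /=; lia.
have odd_b : odd (sumn b).
  rewrite /b /of_gaps /= !oddD !odd_cl !oddB // oddb.
  move: odd_a; rewrite !oddD.
  by case: (odd a0); case: (odd a1); case: (odd a2); case: (odd a3).
have mem (x m : nat) : (x < m)%N -> x \in iota 0 m by rewrite mem_iota.
have lt_odd : (odd a3 < 2)%N by case: (odd a3).
have /allP/(_ _ (mem _ _ lt_odd)) := sides_agree_small.
move=> /allP/(_ _ (mem _ _ (lt_cl (a2 - a3)%N))) /allP/(_ _ (mem _ _ (lt_cl (a1 - a2)%N))).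
move=> /allP/(_ _ (mem _ _ (lt_cl (a0 - a1)%N))).
rewrite -/b odd_b => /andP[/eqP sq /eqP ad]; apply/andP; split; apply/eqP.
  rewrite (symmetrise_shape square_side_shape sh).
  by rewrite (symmetrise_shape (@partition_side_shape 1) sh).
rewrite (symmetrise_shape adams_side_shape sh).
by rewrite (symmetrise_shape (@partition_side_shape (-1)) sh).
Qed.

End FiniteCheck.

(** * From contents to words *)

Section FourColours.

Implicit Types (al : {ffun 'I_4 -> nat}) (f : seq nat -> int).

Definition word4 (al : {ffun 'I_4 -> nat}) : seq nat := [seq al c | c <- enum 'I_4].

Lemma nth_word4 al (c : 'I_4) : nth 0%N (word4 al) c = al c.
Proof. by rewrite (nth_map c) ?size_enum_ord // nth_ord_enum. Qed.

Lemma word4_permute al (u : 'S_4) :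
  word4 [ffun c => al (u c)] = permute_word (word4 al) (perm_word u).
Proof.
rewrite /permute_word /perm_word /word4 -map_comp; apply: eq_map => c.
by rewrite ffunE /= -/(word4 al) nth_word4.
Qed.

Lemma big_ord4 (R : nmodType) (F : 'I_4 -> R) :
  \sum_(c < 4) F c = F (inord 0) + F (inord 1) + F (inord 2) + F (inord 3).
Proof.
rewrite !big_ord_recr big_ord0 /= add0r.
by congr (_ + _ + _ + _); congr F; apply/val_inj; rewrite /= inordK.
Qed.

Lemma word4E al : word4 al = [:: al (inord 0); al (inord 1); al (inord 2); al (inord 3)].
Proof.
apply: (@eq_from_nth _ 0%N); first by rewrite size_map size_enum_ord.
rewrite size_map size_enum_ord => i lt_i.
rewrite -[i]/(nat_of_ord (Ordinal lt_i)) nth_word4.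
by case: i lt_i => [|[|[|[|//]]]] lt_i /=; congr (al _); apply/val_inj; rewrite /= inordK.
Qed.

Lemma symmetriseE f al :
  \sum_(u : 'S_4) (f (word4 [ffun c => al (u c)]))%:~R =
  (symmetrise f (word4 al))%:~R :> algC.
Proof.
under eq_bigr do rewrite word4_permute.
rewrite (@big_signed_perms _ 4 (fun _ p => (f (permute_word (word4 al) p))%:~R)).
by rewrite /symmetrise foldrE big_map rmorph_sum.
Qed.

Lemma symmetrise_permute f al (v : 'S_4) :
  symmetrise f (word4 [ffun c => al (v c)]) = symmetrise f (word4 al).
Proof.
apply: (@intr_inj algC); rewrite -!symmetriseE (reindex_inj (mulIg v^-1%g)) /=.
apply: eq_bigr => u _; congr (f (word4 _))%:~R.
by apply/ffunP=> c; rewrite !ffunE -permM mulgKV.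
Qed.

(** Symmetrised coefficients do not change when the content is sorted. *)
Lemma sides_agree_word4 al : odd (\sum_c al c)%N -> sides_agree (word4 al).
Proof.
move=> odd_al.
have [v sorted_v] : exists v : 'S_4, sorted geq (word4 [ffun c => al (v c)]).
  have : perm_eq (sort geq (word4 al)) [tuple al c | c < 4].
    by rewrite perm_sort.
  case/tuple_permP=> v Ev; exists v.
  have -> : word4 [ffun c => al (v c)] = sort geq (word4 al).
    rewrite Ev /=; apply: eq_map => c; rewrite ffunE.
    by rewrite tnth_mktuple.
  by apply: sort_sorted => x y /=; apply: leq_total.
rewrite /sides_agree -!(symmetrise_permute _ al v) -/(sides_agree _).
have sum_v : (\sum_c [ffun c => al (v c)] c = \sum_c al c)%N.
  by rewrite [RHS](reindex_inj (@perm_inj _ v)); apply: eq_bigr => c _; rewrite ffunE.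
rewrite -sum_v in odd_al; set be := [ffun c => _] in sorted_v odd_al *.
move: sorted_v odd_al; rewrite word4E big_ord4 => /and4P[le10 le21 le32 _].
by apply: sides_agree_sorted.
Qed.

End FourColours.

(** * The square of [k+1,k] *)

Lemma jt_weight_words N la (al : {ffun 'I_N -> nat}) :
  jt_weight la al = \sum_(sp <- signed_perms N) (-1) ^+ nat_of_bool sp.1 *
    [forall c : 'I_N, al c + c == nth 0%N la c + nth 0%N sp.2 c]%N%:R.
Proof.
rewrite -(@big_signed_perms _ N (fun e p => (-1) ^+ nat_of_bool e *
  [forall c : 'I_N, al c + c == nth 0%N la c + nth 0%N p c]%N%:R)).
apply: eq_bigr => w _; congr (_ * (nat_of_bool _)%:R).
by apply: eq_forallb => c; rewrite nth_perm_word.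
Qed.

(** [k+1,k] is the permutation character on k-subsets minus that on
    (k-1)-subsets; the second condition is (al ord_max).+1 == k so that it
    fails for k = 0. *)
Lemma jt_weight_two_rows k (al : {ffun 'I_2 -> nat}) : (\sum_c al c)%N = (2 * k + 1)%N ->
  jt_weight [:: k.+1; k] al = (al ord_max == k)%:R - ((al ord_max).+1 == k)%:R.
Proof.
have forall2 (P : pred 'I_2) : [forall c, P c] = P ord0 && P ord_max.
  apply/forallP/andP=> [H | [H0 H1] c]; first by split; apply: H.
  by case: (unliftP ord0 c) => [j ->|-> //]; rewrite (_ : lift _ _ = ord_max) //;
     apply/val_inj; rewrite /= [j]ord1.
rewrite big_ord_recl big_ord1; have -> : lift ord0 ord0 = ord_max :> 'I_2 by apply/val_inj.
move=> sum_al; rewrite jt_weight_words [signed_perms 2]/= !big_cons big_nil !forall2 /=.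
rewrite mul1r mulN1r addr0; congr (_%:R - _%:R); congr nat_of_bool; rewrite /bump /=; lia.
Qed.

Section OddSquare.

Variables (k n : nat).
Hypothesis hn : n = (2 * k + 1)%N.
Local Notation chi := (part_irr n [:: k.+1; k]).

Definition two_row_weight (al : {ffun bool -> nat}) : algC :=
  (al true == k)%:R - ((al true).+1 == k)%:R.

Lemma two_rowE (g : 'S_n) : chi g = colour_sum two_row_weight g.
Proof.
rewrite (part_irr_colour_sum (N := 2)) //=; last by rewrite leqnSn.
  pose h (b : bool) : 'I_2 := if b then ord_max else ord0.
  pose h' (c : 'I_2) := c == ord_max.
  have hK : cancel h h' by case.
  have h'K : cancel h' h.
    by move=> c; rewrite /h' /h; case: eqP => [//|]; case: c => -[|[|//]] ? // neq;
       [apply/val_inj | case: neq; apply/val_inj].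
  rewrite (colour_sum_bij _ _ hK h'K); apply: eq_colour_sum => al sum_al.
  rewrite jt_weight_two_rows ?ffunE // -hn -sum_al.
  rewrite [RHS](reindex h') /=; last exact: onW_bij (Bijective h'K hK).
  by apply: eq_bigr => c _; rewrite ffunE.
by lia.
Qed.

Definition pair_index (p : bool * bool) : 'I_4 := inord (2 * p.1 + p.2).

Definition index_pair (c : 'I_4) : bool * bool := (1 < c, odd c)%N.

Lemma pair_indexK : cancel pair_index index_pair.
Proof. by move=> [[] []]; rewrite /index_pair /pair_index /= inordK. Qed.

Lemma index_pairK : cancel index_pair pair_index.
Proof.
by case=> -[|[|[|[|//]]]] lt_c; apply/val_inj; rewrite /= inordK.
Qed.

Lemma colour_sum_pairs (phi : {ffun bool * bool -> nat} -> algC)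
    (psi : seq nat -> int) (g : 'S_n) :
  (forall al : {ffun bool * bool -> nat},
     (al (false, false) + al (false, true) + al (true, false) + al (true, true) = n)%N ->
     phi al = (psi [:: al (false, false); al (false, true);
                       al (true, false); al (true, true)])%:~R) ->
  colour_sum phi g = colour_sum (fun al : {ffun 'I_4 -> nat} => (psi (word4 al))%:~R) g.
Proof.
move=> phiE; rewrite (colour_sum_bij _ _ index_pairK pair_indexK).
apply: eq_colour_sum => al; rewrite big_ord4 => sum_al.
by rewrite phiE !ffunE ?word4E.
Qed.

(** With x + y + z + t = 2k+1 the conditions on the left fix the sum and the
    difference of x - t and y - z. *)
Lemma square_side_two_rows x y z t : (x + y + z + t = n)%N ->
  ((z + t == k)%N%:R - ((z + t).+1 == k)%:R) * ((y + t == k)%N%:R - ((y + t).+1 == k)%:R)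
  = (square_side [:: x; y; z; t])%:~R :> algC.
Proof.
move=> sum_xt; rewrite /square_side /=.
have [x1|x1] := eqVneq x (t + 1)%N; last have [x2|x2] := eqVneq x (t + 2)%N;
  last have [x3|x3] := eqVneq x (t + 3)%N.
all: repeat (case: eqP => ?); try (exfalso; lia); rewrite /=; ring.
Qed.

Lemma square_colour_sum (g : 'S_n) :
  chi g * chi g =
  colour_sum (fun al : {ffun 'I_4 -> nat} => (square_side (word4 al))%:~R) g.
Proof.
rewrite two_rowE colour_sumM; apply: colour_sum_pairs => al sum_al.
rewrite /two_row_weight !ffunE !big_bool /=.
by rewrite -(square_side_two_rows sum_al) ![(al (true, true) + _)%N]addnC.
Qed.

(** With x + y + z + t = 2k+1 the conditions on the left amount to x - t = 1 and
    x - t = 3. *)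
Lemma adams_side_two_rows x y z t : (x + y + z + t = n)%N ->
  (-1) ^+ z * (y + z + 2 * t == 2 * k)%N%:R
   - (-1) ^+ z * (2 * t + y + z + 2 == 2 * k)%N%:R
  = (adams_side [:: x; y; z; t])%:~R :> algC.
Proof.
move=> sum_xt; rewrite /adams_side /= rmorphM rmorphB rmorph_sign signr_odd -mulrBr.
have -> : (y + z + 2 * t == 2 * k)%N = (x == t + 1)%N by apply/eqP/eqP; lia.
have -> : (2 * t + y + z + 2 == 2 * k)%N = (x == t + 3)%N by apply/eqP/eqP; lia.
by rewrite !rmorph_nat.
Qed.

Lemma adams_colour_sum (g : 'S_n) :
  chi (g ^+ 2)%g =
  colour_sum (fun al : {ffun 'I_4 -> nat} => (adams_side (word4 al))%:~R) g.
Proof.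
have colour_sumB (C : finType) (phi psi : {ffun C -> nat} -> algC) (s : 'S_n) :
  colour_sum (fun al => phi al - psi al) s = colour_sum phi s - colour_sum psi s.
  by rewrite /colour_sum sumrB.
rewrite two_rowE colour_sumB.
rewrite colour_sum_square.
have -> : colour_sum (fun al : {ffun bool -> nat} => ((al true).+1 == k)%:R) (g ^+ 2)%g =
   colour_sum (fun al : {ffun bool * bool -> nat} => (-1) ^+ al (true, false) *
    (2 * al (true, true) + al (false, true) + al (true, false) + 2 == 2 * k)%N%:R) g.
  (* For k = 0 no colouring satisfies either condition. *)
  case: (k) => [|k']; first by rewrite /colour_sum !big1 // => F _; rewrite addn2 mulr0.
  under eq_colour_sum => al _ do rewrite eqSS.
  rewrite colour_sum_square; apply: eq_colour_sum => al _; congr (_ * (nat_of_bool _)%:R).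
  by apply/eqP/eqP; lia.
rewrite -colour_sumB; apply: colour_sum_pairs => al sum_al.
exact: adams_side_two_rows.
Qed.

Lemma two_row_square_sides (eps : int) (f : seq nat -> int) (g : 'S_n) :
  (forall a, sides_agree a -> symmetrise f a = symmetrise (partition_side eps) a) ->
  colour_sum (fun al : {ffun 'I_4 -> nat} => (f (word4 al))%:~R) g =
  colour_sum (fun al : {ffun 'I_4 -> nat} => (partition_side eps (word4 al))%:~R) g.
Proof.
move=> f_agrees; apply: eq_colour_sum_sym => al sum_al.
rewrite !symmetriseE f_agrees //; apply: sides_agree_word4.
by rewrite sum_al hn oddD oddM.
Qed.

(** Given the content and a permutation w, at most one partition la satisfies
    al_c + c = la_c + w(c) for all c. *)
Lemma sum_partitions4 (eps : int) (al : {ffun 'I_4 -> nat}) : (\sum_c al c)%N = n ->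
  \sum_(la in partitions4 n) (parity_weight eps (count odd (parts4 la)))%:~R
     * jt_weight (parts4 la) al = (partition_side eps (word4 al))%:~R :> algC.
Proof.
move=> sum_al; rewrite /partition_side foldrE big_map rmorph_sum /=.
under eq_bigr do rewrite jt_weight_words mulr_sumr.
rewrite exchange_big /=; apply: eq_big_seq => sp /(allP signed_perms4P).
case: sp => e p /= /and3P[/eqP size_p /eqP sum_p /allP lt_p].
have lt i : (i < 4)%N -> (nth 0%N p i < 4)%N.
  by rewrite -{1}size_p => lt_i; apply/lt_p/mem_nth.
have := (lt 0 isT, lt 1 isT, lt 2 isT, lt 3 isT)%N => -[[[lt0 lt1] lt2] lt3].
have {}sum_p : (nth 0 p 0 + nth 0 p 1 + nth 0 p 2 + nth 0 p 3 = 6)%N.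
  by move: size_p sum_p; case: (p) => [|p0 [|p1 [|p2 [|p3 []]]]] //= _; lia.
have forall4 (P : pred 'I_4) : [forall c, P c] =
    [&& P (inord 0), P (inord 1), P (inord 2) & P (inord 3)].
  apply/forallP/and4P=> [H | [H0 H1 H2 H3] c]; first by split; apply: H.
  by rewrite -[c]inord_val; case: (nat_of_ord c) (ltn_ord c) => [|[|[|[|]]]].
rewrite big_ord4 in sum_al.
move: sum_al; rewrite word4E.
set a0 := al (inord 0); set a1 := al (inord 1); set a2 := al (inord 2).
set a3 := al (inord 3) => sum_al.
have relE (la : 4.-tuple 'I_n.+1) :
    [forall c : 'I_4, al c + c == nth 0%N (parts4 la) c + nth 0%N p c]%N =
    (parts4 la == [:: a0 - nth 0 p 0; a1 + 1 - nth 0 p 1;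
                      a2 + 2 - nth 0 p 2; a3 + 3 - nth 0 p 3]%N)
    && [&& nth 0 p 0 <= a0, nth 0 p 1 <= a1 + 1, nth 0 p 2 <= a2 + 2 & nth 0 p 3 <= a3 + 3]%N.
  rewrite forall4 !inordK //.
  have : size (parts4 la) = 4%N by rewrite size_map size_tuple.
  case: (parts4 la) => [|l0 [|l1 [|l2 [|l3 []]]]] //= _; rewrite !eqseq_cons /= andbT.
  rewrite -/a0 -/a1 -/a2 -/a3; apply/idP/idP; lia.
under eq_bigr do rewrite relE.
set l0 := (a0 - _)%N in relE *; set l1 := (a1 + 1 - _)%N in relE *.
set l2 := (a2 + 2 - _)%N in relE *; set l3 := (a3 + 3 - _)%N in relE *.
set nonneg := [&& _, _, _ & _].
case: ifP => [/and3P[/= ge10 ge21 ge32] | not_part]; last first.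
  rewrite big1 // => la; rewrite inE => /andP[sorted_la _].
  case: (boolP nonneg) => [nn | _]; last by rewrite andbF !mulr0.
  case: (parts4 la =P _) => [la_eq | _]; last by rewrite !mulr0.
  case/negP: not_part; move: sorted_la nn.
  rewrite la_eq /nonneg /is_partition_shift /= /l0 /l1 /l2 /l3.
  lia.
have nn : nonneg by rewrite /nonneg; lia.
have sum_l : (l0 + l1 + l2 + l3 = n)%N by move: nn; rewrite /nonneg /l0 /l1 /l2 /l3; lia.
pose la0 : 4.-tuple 'I_n.+1 := [tuple inord l0; inord l1; inord l2; inord l3].
have la0E : parts4 la0 = [:: l0; l1; l2; l3].
  by rewrite /parts4 /= !inordK //; lia.
have la0_in : la0 \in partitions4 n.
  rewrite inE la0E /= -sum_l; apply/andP; split; last by apply/eqP; lia.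
  by move: nn; rewrite /nonneg /l0 /l1 /l2 /l3; lia.
rewrite (bigD1 la0 la0_in) la0E eqxx nn big1 ?addr0 => [|la /andP[_ la_neq]]; last first.
  case: eqP => [la_eq | _]; last by rewrite !mulr0.
  case/eqP: la_neq; apply/val_inj/(inj_map val_inj).
  by rewrite -/(parts4 la) la_eq -la0E.
have -> : count odd [:: l0; l1; l2; l3] = odd_shifts [:: a0; a1; a2; a3] p.
  move: nn => /and4P[nn0 nn1 nn2 nn3].
  by rewrite /= /l0 /l1 /l2 /l3 !oddB // /odd_shifts /= !oddD; lia.
by rewrite mulr1 rmorphM rmorph_sign [LHS]addr0 mulrC.
Qed.

Lemma part_irr_sum (A : {set 4.-tuple 'I_n.+1}) (g : 'S_n) : A \subset partitions4 n ->
  (\sum_(la in A) part_irr n (parts4 la)) g =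
  colour_sum (fun al : {ffun 'I_4 -> nat} => \sum_(la in A) jt_weight (parts4 la) al) g.
Proof.
move=> /subsetP subA; rewrite sum_cfunE /colour_sum exchange_big /=.
apply: eq_bigr => la /subA; rewrite inE => /andP[sorted_la /eqP sum_la].
by rewrite (part_irr_colour_sum (N := 4)) // size_map size_tuple.
Qed.

Lemma sum_E3O1_E1O3 (eps : int) (g : 'S_n) :
  (\sum_(la in E3O1 n) part_irr n (parts4 la)) g
    + eps%:~R * (\sum_(la in E1O3 n) part_irr n (parts4 la)) g =
  colour_sum (fun al : {ffun 'I_4 -> nat} => (partition_side eps (word4 al))%:~R) g.
Proof.
rewrite !part_irr_sum; try by apply/subsetP=> la; rewrite inE => /andP[].
rewrite /colour_sum mulr_sumr -big_split; apply: eq_bigr => F _ /=.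
rewrite -sum_partitions4 ?sum_content //.
rewrite [RHS](bigID (fun la => count odd (parts4 la) == 1%N)) /=; congr (_ + _).
  apply: eq_big => [la | la]; last first.
    by rewrite inE => /and3P[_ _ /eqP ->]; rewrite mul1r.
  rewrite inE; congr (_ && _); have := count_predC odd (parts4 la).
  by rewrite size_map size_tuple; lia.
rewrite mulr_sumr big_mkcond [RHS]big_mkcond; apply: eq_bigr => la _ /=.
have := count_predC odd (parts4 la); rewrite size_map size_tuple inE.
case: (la \in _) => //= count_la.
rewrite /parity_weight; case: (count odd (parts4 la) =P 3%N) => [E3 | _]; last first.
  by rewrite andbF; case: eqP; rewrite // mul0r.
by rewrite E3 /= (_ : _ == 1%N) //; apply/eqP; lia.
Qed.

End OddSquare.

Theorem theorem7p11 (k n : nat) (hn : n = (2 * k + 1)%N) :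
  cfSym2 (part_irr n [:: k.+1; k])
    = \sum_(la in E3O1 n) part_irr n (parts4 la)
  /\ cfAlt2 (part_irr n [:: k.+1; k])
    = \sum_(la in E1O3 n) part_irr n (parts4 la).
Proof.
have sumE (g : 'S_n) : part_irr n [:: k.+1; k] g ^+ 2 =
    (\sum_(la in E3O1 n) part_irr n (parts4 la)) g
    + (\sum_(la in E1O3 n) part_irr n (parts4 la)) g.
  rewrite -[X in _ + X]mul1r (sum_E3O1_E1O3 hn 1) expr2 (square_colour_sum hn).
  by apply: (two_row_square_sides hn) => a /andP[/eqP].
have diffE (g : 'S_n) : part_irr n [:: k.+1; k] (g ^+ 2)%g =
    (\sum_(la in E3O1 n) part_irr n (parts4 la)) g
    - (\sum_(la in E1O3 n) part_irr n (parts4 la)) g.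
  rewrite -mulN1r (sum_E3O1_E1O3 hn (-1)) (adams_colour_sum hn).
  by apply: (two_row_square_sides hn) => a /andP[_ /eqP].
split; apply/cfunP=> g; rewrite !cfunE in_setT -expr2 sumE diffE.
  by field.
by field.
Qed.
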